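(* Let $G=(V,E)$ be a graph on $n$ vertices that is not isomorphic to the 4-cycle $C_4$. If $\deg(u)+\deg(v)\geq n$ for all pairs of distinct non-adjacent vertices $u,v$ of $G$, then $G$ is rigid in $\mathbb{R}^2$.
   Context: All graphs are finite and simple. A graph is rigid in $\mathbb{R}^d$ if some (equivalently every) generic $d$-dimensional bar-and-joint framework of it (vertex positions with coordinates algebraically independent over $\mathbb{Q}$) is rigid, i.e. admits no continuous edge-length-preserving motion changing some pairwise distance. *)

(* Defs.v *)
From HB Require Import structures.
From mathcomp Require Import all_boot all_order all_algebra.
From mathcomp Require Import mpoly.
From mathcomp Require Import Rstruct.
From Stdlib Require Import Reals.
Set Implicit Arguments. Unset Strict Implicit. Unset Printing Implicit Defensive.
Import Order.TTheory GRing.Theory Num.Theory.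
Local Open Scope ring_scope.

Definition simple_graph (n : nat) (e : rel 'I_n) : Prop :=
  (forall u v, e u v = e v u) /\ (forall u, e u u = false).

Definition deg (n : nat) (e : rel 'I_n) (u : 'I_n) : nat := #|[set v | e u v]|.

Definition C4_adj : rel 'I_4 :=
  fun i j => (modn (nat_of_ord i).+1 4 == nat_of_ord j) || (modn (nat_of_ord j).+1 4 == nat_of_ord i).

Definition iso_C4 (n : nat) (e : rel 'I_n) : Prop :=
  exists f : 'I_n -> 'I_4, bijective f /\ forall u v, e u v = C4_adj (f u) (f v).

(* A 2-dimensional framework: row i = position of vertex i. *)
Definition framework (n : nat) := 'M[R]_(n, 2).

Definition sqdist (n : nat) (X : framework n) (i j : 'I_n) : R :=
  \sum_(k < 2) (X i k - X j k) ^+ 2.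

Definition generic (n : nat) (X : framework n) : Prop :=
  forall P : {mpoly rat[n * 2]}, P != 0 ->
    (map_mpoly (ratr : rat -> R) P).@[fun k => mxvec X 0 k] != 0.

Definition in01 (t : R) : bool := (0 <= t) && (t <= 1).

Definition continuous_path (n : nat) (Y : R -> framework n) : Prop :=
  forall (i : 'I_n) (k : 'I_2) (t : R), in01 t ->
  forall eps : R, 0 < eps -> exists2 delta : R, 0 < delta &
    forall s : R, in01 s -> `|s - t| < delta -> `|Y s i k - Y t i k| < eps.

Definition framework_rigid (n : nat) (e : rel 'I_n) (X : framework n) : Prop :=
  forall Y : R -> framework n,
    continuous_path Y -> Y 0 = X ->
    (forall t, in01 t -> forall i j, e i j -> sqdist (Y t) i j = sqdist X i j) ->
    forall t, in01 t -> forall i j, sqdist (Y t) i j = sqdist X i j.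

Definition rigid2 (n : nat) (e : rel 'I_n) : Prop :=
  forall X : framework n, generic X -> framework_rigid e X.

(* Main.v *)
(** Fix a generic framework [X] and replace the graph by its closure: [i] and [j]
are joined when the rigidity row of [ij] is spanned by the rows of the edges.
This keeps the rank and the degree condition, and in a closed graph rigid vertex
sets are cliques, so two maximal cliques share at most one vertex, and a vertex
with three neighbours not all adjacent raises the rank by 3 (1-extension).
Consequently the rank is at least the sum of [2|L| - 3] over the maximal cliques
[L].  If the neighbourhood of some vertex is a clique, Ore's condition forces the
graph to be complete; if it is the union of two cliques, the graph is [C4] or
contains a triangular prism, which is rigid; if every neighbourhood contains three
independent vertices, either the rank is full or at least eight vertices have
degree 3, against Ore's condition.  Full rank at [X] gives rigidity, because the
difference of two equivalent frameworks is an infinitesimal flex of their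
midpoint, and the rank depends only on the pairwise distances. *)
Require Import Defs.
From HB Require Import structures.
From mathcomp Require Import mpoly.
From mathcomp Require Import all_boot all_order all_algebra.
From mathcomp Require Import boolp Rstruct zify ring lra.
Set Implicit Arguments. Unset Strict Implicit. Unset Printing Implicit Defensive.
Import Order.TTheory GRing.Theory Num.Theory.

(** * Combinatorial properties of the rank *)

(** [f S] stands for the rank of the subgraph induced on [S] in a closed graph at a generic
    position; the combinatorial half uses only these six facts. [rank_add3] is 1-extension, and
    [rank_clique] expresses closedness: rigid sets are cliques. *)
Record rigidity_rank (V : finType) (e : rel V) (f : {set V} -> nat) : Prop :=
  RigidityRank {
  rank_le (S : {set V}) : 1 < #|S| -> f S <= #|S|.*2 - 3;
  rank_mono v (S : {set V}) : f S <= f (v |: S);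
  rank_add1 v a (S : {set V}) : v \notin S -> a \in S -> e v a -> (f S).+1 <= f (v |: S);
  rank_add2 v a b (S : {set V}) : v \notin S -> a \in S -> b \in S -> a != b ->
    e v a -> e v b -> (f S).+2 <= f (v |: S);
  rank_add3 v a b c (S : {set V}) : v \notin S -> a \in S -> b \in S -> c \in S ->
    a != b -> a != c -> b != c -> e v a -> e v b -> e v c -> ~~ e a b ->
    (f S).+3 <= f (v |: S);
  rank_clique (S : {set V}) x y : 1 < #|S| -> #|S|.*2 - 3 <= f S ->
    x \in S -> y \in S -> x != y -> e x y }.

Section LineWeights.
Local Open Scope ring_scope.

(** The share of each vertex when a clique on [k] vertices divides [2k - 3] equally; truncated
    subtraction makes it 0 for [k <= 1]. *)
Definition line_weight (k : nat) : rat := (k.*2 - 3)%:R / k%:R.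

(** Double counting of the incidences between vertices and cliques. *)
Lemma sum_line_weight (V I : finType) (L : I -> {set V}) (S : {set V}) :
  (forall i, L i \subset S) ->
  \sum_(v in S) \sum_(i | v \in L i) line_weight #|L i| =
  (\sum_i (#|L i|.*2 - 3))%:R.
Proof.
move=> LS; rewrite (exchange_big_dep predT) //= natr_sum.
apply: eq_bigr => i _; rewrite (eq_bigl (mem (L i))); last first.
  by move=> v /=; case vL: (v \in L i); rewrite ?andbF // (subsetP (LS i)).
rewrite sumr_const /line_weight -[LHS]mulr_natr; case: #|L i| => [|k].
  by rewrite mulr0.
by rewrite mulfVK // pnatr_eq0.
Qed.

Lemma line_weight_ge0 k : 0 <= line_weight k.
Proof. by rewrite divr_ge0 // ler0n. Qed.

Lemma line_weight_half k : (1 < k)%N -> 1 / 2%:R <= line_weight k.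
Proof.
move=> k1; have k0 : (0 : rat) < k%:R by rewrite ltr0n; lia.
rewrite /line_weight ler_pdivlMr // mulrAC ler_pdivrMr ?ltr0n //.
by rewrite mul1r -natrM ler_nat; lia.
Qed.

Lemma line_weight1 k : (2 < k)%N -> 1 <= line_weight k.
Proof.
move=> k1; have k0 : (0 : rat) < k%:R by rewrite ltr0n; lia.
by rewrite /line_weight ler_pdivlMr // mul1r ler_nat; lia.
Qed.

(** Losing a vertex costs a pair 1, twice its weight 1/2; it costs a larger clique 2, and the weight
    is then at least 1. *)
Lemma line_weight_drop k :
  ((k.*2 - 3) - (k.-1.*2 - 3))%:R <= 2%:R * line_weight k.
Proof.
case: k => [|[|[|k]]]; rewrite ?mulr_ge0 ?line_weight_ge0 //.
have := @line_weight1 k.+3 isT; set w := line_weight _ => w1.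
have -> : (k.+3.*2 - 3 - (k.+3.-1.*2 - 3) = 2)%N by lia.
lra.
Qed.

End LineWeights.

(** * Rank bound from a family of cliques *)

Section RankTheory.
Variables (V : finType) (e : rel V) (f : {set V} -> nat).
Hypotheses (esym : symmetric e) (eirr : irreflexive e).
Hypothesis fP : rigidity_rank e f.

Definition clique (S : {set V}) := forall x y, x \in S -> y \in S -> x != y -> e x y.

(* If the bound is at least [2|S|], shrinking a line contradicts [rank_le].
   Otherwise averaging gives a vertex whose lines have total weight less than 2;
   deleting it lowers the bound by at most 3, and by no more than the rank. *)
Lemma line_rank (I : finType) (L : I -> {set V}) (S : {set V}) :
  (forall i, L i \subset S) -> (forall i, clique (L i)) ->
  (forall i j x a b, i != j -> x \in L i -> x \in L j ->
     a \in L i -> b \in L j -> a != x -> b != x -> (a != b) && ~~ e a b) ->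
  \sum_i (#|L i|.*2 - 3) <= f S.
Proof.
have [m] := ubnP (#|S| + \sum_i #|L i|).
elim: m => // m IH in L S *; rewrite ltnS => lem LS Lcl Lsep.
(* The hypotheses are inherited by smaller lines, so the induction applies as soon as the total size
   decreases. *)
have shrink (L' : I -> {set V}) (S' : {set V}) :
    (forall i, L' i \subset L i) -> (forall i, L' i \subset S') ->
    #|S'| + \sum_i #|L' i| < #|S| + \sum_i #|L i| ->
    \sum_i (#|L' i|.*2 - 3) <= f S'.
  move=> sub LS' lt; apply: IH => //; first exact: leq_trans lt lem.
    move=> i x y /(subsetP (sub i)) xi /(subsetP (sub i)) yi; exact: (Lcl i).
  move=> i j x a b ij /(subsetP (sub i)) xi /(subsetP (sub j)) xj.
  move=> /(subsetP (sub i)) ai /(subsetP (sub j)) bj; exact: (Lsep i j).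
have [S1|S1] := leqP #|S| 1.
  rewrite big1 // => i _; have := subset_leq_card (LS i); lia.
have [big|small] := leqP #|S|.*2 (\sum_i (#|L i|.*2 - 3)).
  have [i Li] : exists i, 1 < #|L i|.
    apply/existsP; apply: contraLR big; rewrite negb_exists => /forallP h.
    rewrite big1 => [|i _]; last by have := h i; lia.
    rewrite leqn0 double_eq0. by rewrite -lt0n ltnW.
  have [x xi] : exists x, x \in L i by apply/card_gt0P; lia.
  (* Removing [x] lowers the sum by at most 2, which leaves at least [2|S| - 2]. *)
  pose L' j := if j == i then L i :\ x else L j.
  have := shrink L' S; rewrite (bigD1 i) //= [X in _ -> _ -> X -> _]/= => h.
  have cx : #|L i| = (#|L i :\ x|).+1 by rewrite (cardsD1 x) xi.
  have e1 : \sum_(j | j != i) (#|L' j|.*2 - 3) = \sum_(j | j != i) (#|L j|.*2 - 3).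
    by apply: eq_bigr => j /negPf ji; rewrite /L' ji.
  have e2 : \sum_j #|L' j| = #|L i :\ x| + \sum_(j | j != i) #|L j|.
    rewrite (bigD1 i) //= {1}/L' eqxx; congr addn.
    by apply: eq_bigr => j /negPf ji; rewrite /L' ji.
  have := rank_le fP S1; move: big; rewrite !(bigD1 (P := predT) i) //=.
  have {h} : \sum_j (#|L' j|.*2 - 3) <= f S.
    apply: shrink; rewrite ?e2 ?(bigD1 (P := predT) i) //=; last lia.
      by move=> j; rewrite /L'; case: eqP => [->|_] //; exact: subsetDl.
    by move=> j; rewrite /L'; case: eqP => _ //; rewrite (subset_trans (subsetDl _ _)).
  rewrite (bigD1 (P := predT) i) //= e1 {1}/L' eqxx; lia.
pose s v := (\sum_(i | v \in L i) line_weight #|L i|)%R.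
have [v vS sv] : exists2 v, v \in S & (s v < 2%:R)%R.
  apply/exists_inP; apply: contraLR small; rewrite negb_exists_in => /forall_inP h.
  rewrite -leqNgt -(ler_nat rat) -(sum_line_weight LS) -muln2 natrM.
  rewrite mulr_natl -sumr_const; apply: ler_sum => v /h; by rewrite -leNgt.
pose L' i := L i :\ v.
pose drop i := (#|L i|.*2 - 3) - (#|L' i|.*2 - 3).
have cL i : #|L i| = (v \in L i) + #|L' i| by rewrite (cardsD1 v).
have dropE : \sum_i (#|L i|.*2 - 3) = \sum_i (#|L' i|.*2 - 3) + \sum_(i | v \in L i) drop i.
  rewrite [X in _ + X]big_mkcond -big_split; apply: eq_bigr => i _ /=.
  by rewrite /drop (cL i); case: (v \in L i); lia.
(* Each drop is at most twice the weight of its line, so the total is less than 4. *)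
have drop3 : \sum_(i | v \in L i) drop i <= 3.
  rewrite -ltnS -(ltr_nat rat) natr_sum.
  apply: le_lt_trans (_ : 2%:R * s v < _)%R; last by lra.
  rewrite mulr_sumr; apply: ler_sum => i vi.
  have := line_weight_drop #|L i|; rewrite {2}(cL i) vi add1n; exact.
pose N := [set x in S :\ v | e v x].
(* Lines through [v] meet only in [v], so their other vertices are distinct neighbours of [v], and
   no line drops by more than the number of its other vertices. *)
have dropN : \sum_(i | v \in L i) drop i <= #|N|.
  apply: leq_trans (_ : \sum_(i | v \in L i) #|L' i| <= _).
    by apply: leq_sum => i vi; rewrite /drop (cL i) vi; lia.
  rewrite -sum1_card; under eq_bigr do rewrite -sum1_card.
  rewrite (exchange_big_dep (mem N)) /=; last first.
    move=> i x vi; rewrite !inE => /andP[xv xi]; rewrite xv (subsetP (LS i)) //.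
    by apply: (Lcl i) => //; rewrite eq_sym.
  apply: leq_sum => x xN; rewrite sum1_card; apply/card_le1P => i.
  rewrite unfold_in !inE => /and3P[vi xv xi] j.
  apply/idP/eqP => [|->]; rewrite unfold_in !inE; last by rewrite vi xv.
  move=> /and3P[vj _ xj]; apply/eqP/negPn/negP; rewrite eq_sym => ij.
  by have := Lsep i j v x x ij vi vj xi xj xv xv; rewrite eqxx.
have IHS : \sum_i (#|L' i|.*2 - 3) <= f (S :\ v).
  apply: shrink => [i|i|]; rewrite /L' ?subsetDl ?setSD //.
  rewrite [#|S|](cardsD1 v) vS /= ltnS leq_add2l.
  by apply: leq_sum => i _; rewrite subset_leq_card ?subsetDl.
have vS' : v \notin S :\ v by rewrite !inE eqxx.
rewrite dropE -(setD1K vS); apply: leq_trans (leq_add IHS (leqnn _)) _.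
have NE x : x \in N -> x \in S :\ v /\ e v x by rewrite inE => /andP[].
have pos (Q : pred I) : 0 < \sum_(i | Q i) drop i -> exists2 i, Q i & 0 < drop i.
  move=> h; apply/exists_inP; apply: contraLR h; rewrite negb_exists_in => /forall_inP h.
  by rewrite big1 // => i /h; lia.
case r_eq : (\sum_(i | v \in L i) drop i) drop3 dropN => [|[|[|[|r]]]] // _ dropN.
- by rewrite addn0; exact: rank_mono fP _ _.
- have /card_gt0P[a /NE[aS va]] := dropN.
  by rewrite addn1; exact: rank_add1 fP _ _ _ vS' aS va.
- have /card_gt1P[a [b [/NE[aS va] /NE[bS vb] ab]]] := dropN.
  by rewrite addn2; exact: rank_add2 fP _ _ _ _ vS' aS bS ab va vb.
(* One line drops by at most 2, so a total of 3 involves two lines; a vertex from each gives the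
   non-adjacent pair required by 1-extension. *)
have [|i vi di] := pos (fun i => v \in L i); first by rewrite r_eq.
have [|j /andP[vj ji] dj] := pos (fun j => (v \in L j) && (j != i)).
  have d2 : drop i <= 2 by rewrite /drop (cL i) vi; lia.
  by move: r_eq; rewrite (bigD1 i) //=; lia.
have [a] : exists a, a \in L' i by apply/card_gt0P; move: di; rewrite /drop (cL i) vi; lia.
have [b] : exists b, b \in L' j by apply/card_gt0P; move: dj; rewrite /drop (cL j) vj; lia.
rewrite !inE => /andP[bv bj] /andP[av ai].
rewrite eq_sym in ji.
have /andP[ab nab] := Lsep i j v a b ji vi vj ai bj av bv.
have inN k x : v \in L k -> x != v -> x \in L k -> x \in N.
  move=> vk xv xk; rewrite !inE xv (subsetP (LS k)) //=.
  by apply: (Lcl k) => //; rewrite eq_sym.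
have aN := inN _ _ vi av ai; have bN := inN _ _ vj bv bj.
have [c] : exists c, c \in N :\ a :\ b.
  apply/card_gt0P; move: dropN; rewrite (cardsD1 a N) aN (cardsD1 b (N :\ a)).
  by rewrite in_setD1 eq_sym ab bN.
rewrite in_setD1 => /andP[cb]; rewrite in_setD1 => /andP[ca /NE[cS vc]].
have [aS va] := NE _ aN; have [bS vb] := NE _ bN.
rewrite addn3; apply: (rank_add3 fP (a := a) (b := b) (c := c)) => //; by rewrite eq_sym.
Qed.

(** * Diamonds and prisms *)

Lemma adj_neq x y : e x y -> x != y.
Proof. by apply: contraTneq => ->; rewrite eirr. Qed.

(** Two triangles on a common edge have rank at least 1 + 2 + 2 = 5, which is full for four
    vertices, so these form a clique. *)
Lemma diamond_adj a b x y :
  e a b -> e x a -> e x b -> e y a -> e y b -> x != y -> e x y.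
Proof.
move=> ab xa xb ya yb xy.
have [[[[nab nxa] nxb] nya] nyb] :=
  (adj_neq ab, adj_neq xa, adj_neq xb, adj_neq ya, adj_neq yb).
pose S := y |: (x |: (b |: [set a])).
have cS : #|S| = 4.
  by rewrite !cardsU1 cards1 !inE (eq_sym b) !negb_or nab nxa nxb nya nyb eq_sym xy.
apply: (rank_clique fP (S := S)); rewrite ?cS ?inE ?eqxx ?orbT //.
have s1 : 1 <= f (b |: [set a]).
  apply: leq_trans (rank_add1 fP (a := a) _ _ _); rewrite ?inE ?(eq_sym b) //.
  by rewrite esym.
have s2 := rank_add2 fP (v := x) (a := a) (b := b) (S := b |: [set a]).
have s3 := rank_add2 fP (v := y) (a := a) (b := b) (S := x |: (b |: [set a])).
apply: leq_trans (s3 _ _ _ _ _ _); rewrite ?inE ?eqxx ?orbT ?negb_or ?(eq_sym y x) ?xy ?nya ?nyb //.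
by rewrite !ltnS; apply: leq_trans (s2 _ _ _ _ _ _); rewrite ?inE ?eqxx ?orbT ?negb_or ?nxa ?nxb.
Qed.

(** The triangles [v a a'] and [b u u'], joined by [vb], [au] and [a'u'], form a prism. If [b] and
    [a'] were not adjacent, adding [b], [u], [u'] in turn to the first triangle would raise the rank
    by 1, 2 and 3, to 9, which is full for six vertices; the last addition is a 1-extension on the
    pair [b a']. *)
Lemma prism_adj v a a' b u u' :
  uniq [:: v; a; a'; b; u; u'] ->
  e v a -> e v a' -> e a a' -> e b u -> e b u' -> e u u' ->
  e v b -> e a u -> e a' u' -> e b a'.
Proof.
move=> U va va' aa' bu bu' uu' vb au a'u'; apply: contraT => nba'.
pose S1 := a |: [set v]; pose S2 := a' |: S1; pose S3 := b |: S2.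
pose S4 := u |: S3; pose S5 := u' |: S4.
have U' : uniq [:: u'; u; b; a'; a; v] by rewrite -(rev_uniq [:: v; a; a'; b; u; u']) in U.
move: U'; rewrite /= !inE !negb_or.
case/and5P=> /and5P[n1 n2 n3 n4 n5] /and4P[n6 n7 n8 n9] /and3P[n10 n11 n12].
case/andP=> n13 n14 /andP[n15 _].
have cS : #|S5| = 6.
  by rewrite !cardsU1 cards1 !inE !negb_or n1 n2 n3 n4 n5 n6 n7 n8 n9 n10 n11 n12 n13 n14 n15.
have r1 : 1 <= f S1.
  apply: leq_trans (rank_add1 fP (a := v) _ _ _); rewrite ?inE //; last by rewrite esym.
have r2 : 3 <= f S2.
  apply: leq_trans (rank_add2 fP (a := v) (b := a) _ _ _ _ _ _);
    rewrite ?inE ?eqxx ?negb_or ?n13 ?orbT // ?(eq_sym v a) // ?(esym a') //.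
have r3 : 4 <= f S3.
  apply: leq_trans (rank_add1 fP (a := v) _ _ _);
    rewrite ?inE ?eqxx ?negb_or ?n10 ?n11 ?n12 ?orbT // ?(esym b) //.
have r4 : 6 <= f S4.
  apply: leq_trans (rank_add2 fP (a := b) (b := a) _ _ _ _ _ _);
    rewrite ?inE ?eqxx ?negb_or ?n6 ?n7 ?n8 ?n9 ?orbT // ?(esym u) //.
have r5 : 9 <= f S5.
  apply: leq_trans (rank_add3 fP (a := b) (b := a') (c := u) _ _ _ _ _ _ _ _ _ _ _);
    rewrite ?inE ?eqxx ?negb_or ?n1 ?n2 ?n3 ?n4 ?n5 ?orbT // ?(esym u') // eq_sym //.
by rewrite -(negPf nba'); apply: (rank_clique fP (S := S5)); rewrite ?cS ?inE ?eqxx ?orbT.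
Qed.

(** * Neighbourhoods made of one or two cliques *)

Definition nbhd u := [set x | e u x].

(** Two common neighbours inside a clique would form a diamond with [u] and [v]. *)
Lemma nonadj_share_le1 v u (A : {set V}) :
  u != v -> ~~ e v u -> clique A -> (forall x, x \in A -> e v x) ->
  #|nbhd u :&: A| <= 1.
Proof.
move=> uv nvu Acl vA; apply/card_le1_eqP => x y.
rewrite !inE => /andP[ux xA] /andP[uy yA]; apply/eqP; apply: contraNT nvu => xy.
by apply: (diamond_adj (Acl _ _ yA xA xy)); rewrite ?vA // eq_sym.
Qed.

Hypothesis ore :
  forall u v, u != v -> ~~ e u v -> #|V| <= #|nbhd u| + #|nbhd v|.

(** A vertex [u] not adjacent to [v] has at most one neighbour in [nbhd v] and misses both [v] and
    itself, so its degree is at most [|V| - 1 - deg v], against Ore's condition. Hence [v] sees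
    every other vertex and the graph is complete. *)
Lemma clique_nbhd_complete v : clique (nbhd v) -> #|V|.*2 - 3 <= f setT.
Proof.
move=> cl.
have vadj u : u != v -> e v u.
  move=> uv; apply: contraT => nvu.
  have le1 : #|nbhd u :&: nbhd v| <= 1.
    by apply: (nonadj_share_le1 uv nvu cl) => x; rewrite inE.
  have cv : #|v |: nbhd v| = #|nbhd v|.+1 by rewrite cardsU1 inE eirr.
  have cC := cardsC (v |: nbhd v).
  have cu : #|nbhd u :\: nbhd v| < #|~: (v |: nbhd v)|.
    apply: proper_card; apply/properP; split.
      apply/subsetP => x; rewrite !inE => /andP[nvx ux]; rewrite negb_or nvx andbT.
      by apply: contraNneq nvu => <-; rewrite esym.
    by exists u; rewrite !inE ?eirr ?andbF // negb_or uv nvu.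
  have := ore uv; rewrite esym => /(_ nvu).
  by rewrite -(cardsID (nbhd v) (nbhd u)); lia.
have all_adj x y : x != y -> e x y.
  have [->|xv] := eqVneq x v; first by rewrite eq_sym; exact: vadj.
  have [->|yv xy] := eqVneq y v; first by rewrite esym => _; exact: vadj.
  by apply: cl; rewrite ?inE ?vadj.
(* The whole vertex set is a single line. *)
have := @line_rank 'I_1 (fun=> setT) setT.
rewrite big_ord1 cardsT; apply=> // [i x y _ _|i j]; first exact: all_adj.
by rewrite (ord1 i) (ord1 j) eqxx.
Qed.

(** The cycle [v a w b], given by its two pairs of opposite vertices. *)
Definition is_C4 :=
  exists v a b w, [/\ #|V| = 4, [/\ e v a, e v b, e w a & e w b],
    v != w, a != b & ~~ e v w /\ ~~ e a b].

Definition non_nbhd v := [set u | (u != v) && ~~ e v u].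

(** Here [nbhd v] is the clique [A] together with the isolated neighbour [b]. A second vertex [x] of
    [A] gives a prism making [b] and [x] adjacent; if [A] is just [a], two vertices outside [nbhd v]
    would form a diamond with [a] and [b]. *)
Lemma pendant_C4 v a b (A : {set V}) :
  e v b -> a \in A -> clique A -> (forall x, x \in A -> e v x) ->
  (forall x, x \in A -> x != b /\ ~~ e x b) ->
  (forall u, u \in non_nbhd v -> e u b) -> clique (non_nbhd v) ->
  (forall x, x \in A -> exists2 u, u \in non_nbhd v & e x u) ->
  (forall u, u \in non_nbhd v -> #|nbhd u :&: A| = 1) ->
  #|V| = #|A| + #|non_nbhd v| + 2 -> is_C4.
Proof.
move=> vb aA Acl vA Ab Wb Wcl AW WA cV.
have uniqA u x y : u \in non_nbhd v -> x \in A -> y \in A -> e u x -> e u y -> x = y.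
  move=> uW xA yA ux uy; have /eqP := WA u uW; rewrite eqn_leq => /andP[/card_le1_eqP h _].
  by apply: h; rewrite !inE ?ux ?uy.
have [u uW au] := AW a aA.
have := uW; rewrite inE => /andP[uv nvu].
have [/existsP[x /andP[xa xA]]|] := boolP [exists x, (x != a) && (x \in A)].
  have [u' u'W xu'] := AW x xA.
  have := u'W; rewrite inE => /andP[u'v nvu'].
  (* A vertex of [non_nbhd v] has only one neighbour in [A]. *)
  have uu' : u != u'.
    apply: contraNneq xa => uu'; apply/eqP; apply: (uniqA u) => //; rewrite esym //.
    by rewrite uu'.
  have [nxb nexb] := Ab x xA; have [nab _] := Ab a aA.
  have out w y : w \in non_nbhd v -> e v y -> y != w.
    by rewrite inE => /andP[_ nvw] vy; apply: contraNneq nvw => <-.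
  suff: e b x by rewrite esym (negPf nexb).
  apply: (@prism_adj v a x b u u'); rewrite ?vb ?vA //;
    try by [exact: Wcl|apply: Acl => //; rewrite eq_sym].
  - rewrite /= !inE !negb_or (adj_neq vb) (adj_neq (vA a aA)) (adj_neq (vA x xA)).
    rewrite !(eq_sym v) uv u'v (eq_sym a x) xa nab nxb uu' !(out u) ?vb ?vA //.
    by rewrite !(out u') ?vb ?vA.
  - by rewrite esym Wb.
  - by rewrite esym Wb.
rewrite negb_exists => /forallP Aa.
have A1 : A = [set a].
  apply/setP => x; rewrite inE; apply/idP/eqP => [xA|-> //].
  by have := Aa x; rewrite xA andbT negbK => /eqP.
have [nab neab] := Ab a aA.
have W1 : non_nbhd v = [set u].
  apply/setP => w; apply/idP/set1P => [wW|-> //]; apply/eqP; apply: contraNT neab => wu.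
  have wa : e w a.
    have /eqP/cards1P[y] := WA w wW; rewrite A1 => /setP/(_ y); rewrite !inE eqxx.
    by case/andP=> wy /eqP <-.
  apply: (@diamond_adj u w) => //; first by apply: Wcl => //; rewrite eq_sym.
  - by rewrite esym.
  - by rewrite esym Wb.
  - by rewrite esym Wb.
exists v, a, b, u; split=> //.
- by rewrite cV A1 W1 !cards1.
- by split=> //; [exact: vA | rewrite esym | exact: Wb].
- by rewrite eq_sym.
Qed.

(** The neighbourhood of [v] splits into disjoint cliques [A] and [B] with no edges between them.
    Counting edges to the set [W] of non-neighbours shows that one of the cliques is a single
    vertex, and then [pendant_C4] applies. *)
Lemma two_cliques_C4 v a b :
  e v a -> e v b -> a != b -> ~~ e a b ->
  (forall x, e v x -> [|| x == a, x == b, e a x | e b x]) -> is_C4.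
Proof.
move=> va vb ab nab cover.
pose K c := [set x | e v x && ((x == c) || e c x)].
have Kcl c : e v c -> clique (K c).
  move=> vc x y; rewrite !inE => /andP[vx /orP[/eqP->|cx]] /andP[vy /orP[/eqP->|cy]] xy.
  - by rewrite eqxx in xy.
  - by [].
  - by rewrite esym.
  - by apply: (@diamond_adj v c) => //; rewrite esym.
have Kv c x : x \in K c -> e v x by rewrite inE => /andP[].
have Kdis c d x : e v c -> e v d -> c != d -> ~~ e c d -> x \in K c -> x \notin K d.
  move=> vc vd cd ncd; rewrite !inE => /andP[vx xc]; rewrite vx /=.
  apply/negP => xd; move: xc xd.
  case/orP=> [/eqP->|cx]; first by rewrite (negPf cd) esym (negPf ncd).
  case/orP=> [/eqP xd|dx]; first by rewrite -xd cx in ncd.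
  by case/negP: ncd; apply: (@diamond_adj v x) => //; rewrite esym.
have Ksep c d x y : e v c -> e v d -> c != d -> ~~ e c d ->
    x \in K c -> y \in K d -> x != y /\ ~~ e x y.
  move=> vc vd cd ncd xc yd; split.
    by apply: contraTneq yd => <-; exact: Kdis xc.
  have dc : d != c by rewrite eq_sym.
  have ndc : ~~ e d c by rewrite esym.
  apply/negP => xy.
  have /negP := Kdis _ _ _ vd vc dc ndc yd; apply.
  rewrite inE (Kv _ _ yd) /=; have [//|yc /=] := eqVneq y c.
  have := xc; rewrite inE => /andP[vx /orP[/eqP <- //|cx]].
  apply: (@diamond_adj v x) => //; rewrite 1?esym ?(Kv _ _ yd) //; by rewrite eq_sym.
set A := K a; set B := K b; set W := non_nbhd v.
have aA : a \in A by rewrite inE va eqxx.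
have bB : b \in B by rewrite inE vb eqxx.
have ba : b != a by rewrite eq_sym.
have nba : ~~ e b a by rewrite esym.
(* Any set is counted over the partition of the vertices into [v], [A], [B] and [W]. *)
have part (N : {set V}) : #|N| = (v \in N) + #|N :&: A| + #|N :&: B| + #|N :&: W|.
  have -> : (v \in N : nat) = #|[set x in N | x == v]|.
    have [vN|vN] := boolP (v \in N).
      by rewrite /= -(cards1 v); apply: eq_card => x; rewrite !inE andbC; case: eqP => // ->.
    rewrite /=; symmetry; apply/eqP; rewrite cards_eq0; apply/eqP/setP => x.
    by rewrite !inE andbC; case: eqP => // ->; exact/negbTE.
  rewrite -!sum1_card !(big_mkcond (fun x => x \in _)) -!big_split /=.
  apply: eq_bigr => x _; rewrite !inE; case: (x \in N) => //=.
  have [->|xv] := eqVneq x v; first by rewrite eirr.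
  case vx: (e v x) => //=.
  have := cover x vx; have := Kdis a b x va vb ab nab; rewrite !inE vx /=.
  by case: (x == a); case: (x == b); case: (e a x); case: (e b x) => //= /(_ isT).
have cV : #|V| = 1 + #|A| + #|B| + #|W| by rewrite -cardsT (part setT) !setTI inE.
have dv : #|nbhd v| = #|A| + #|B|.
  rewrite (part (nbhd v)) inE eirr.
  have -> : nbhd v :&: A = A by apply/setIidPr/subsetP => x /Kv; rewrite inE.
  have -> : nbhd v :&: B = B by apply/setIidPr/subsetP => x /Kv; rewrite inE.
  have -> : nbhd v :&: W = set0 by apply/setP => x; rewrite !inE; case: (e v x); rewrite ?andbF.
  by rewrite cards0 addn0.
(* Ore's condition for [u] and [v] demands [deg u >= 1 + |W|], while the bounds 1, 1 and [|W| - 1]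
   on the three parts allow no more; all three are attained. *)
have Wu u : u \in W -> [/\ #|nbhd u :&: A| = 1, #|nbhd u :&: B| = 1 & nbhd u :&: W = W :\ u].
  move=> uW; have := uW; rewrite inE => /andP[uv nvu].
  have hA := nonadj_share_le1 uv nvu (Kcl a va) (Kv a).
  have hB := nonadj_share_le1 uv nvu (Kcl b vb) (Kv b).
  have sub : nbhd u :&: W \subset W :\ u.
    apply/subsetP => x; rewrite !inE => /andP[ux ->]; rewrite andbT.
    by apply: contraTneq ux => ->; rewrite eirr.
  have cW : #|W| = #|W :\ u|.+1 by rewrite (cardsD1 u W) uW.
  have := ore uv; rewrite esym => /(_ nvu).
  rewrite (part (nbhd u)) inE esym (negPf nvu) dv cV => h.
  have h' := subset_leq_card sub; rewrite -/A -/B in hA hB.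
  suff [h1 h2 h3] : [/\ #|nbhd u :&: A| = 1, #|nbhd u :&: B| = 1 & #|W :\ u| <= #|nbhd u :&: W|].
    by split=> //; apply/eqP; rewrite eqEcard sub h3.
  by move: h h' hA hB cW; clear => h h' hA hB cW; split; lia.
(* Within [nbhd v], [x] and [y] see only their own cliques, so Ore's condition forces many
   neighbours in [W]. *)
have AB x y : x \in A -> y \in B -> 1 + #|W| <= #|nbhd x :&: W| + #|nbhd y :&: W|.
  move=> xA yB; have [xy nxy] := Ksep a b x y va vb ab nab xA yB.
  have side c d z : e v c -> e v d -> c != d -> ~~ e c d -> z \in K c ->
      #|nbhd z :&: K c| < #|K c| /\ nbhd z :&: K d = set0.
    move=> vc vd cd ncd zc; split.
      apply: proper_card; apply/properP; split; first exact: subsetIr.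
      by exists z => //; rewrite !inE eirr.
    apply/setP => t; rewrite !inE; apply/negP => /andP[zt td].
    have := Ksep c d z t vc vd cd ncd zc; rewrite inE => /(_ td)[_ /negP]; exact.
  have [xx xB] := side a b x va vb ab nab xA.
  have [yy yA] := side b a y vb va ba nba yB.
  have := ore xy nxy; rewrite (part (nbhd x)) (part (nbhd y)) xB yA !cards0 !inE.
  rewrite !(esym _ v) (Kv _ _ xA) (Kv _ _ yB) cV; rewrite -/A -/B in xx yy *.
  by move: xx yy; clear; lia.
(* A common neighbour in [W] would have two neighbours in [C]. *)
have dis (C : {set V}) x y : (forall u, u \in W -> #|nbhd u :&: C| = 1) -> x \in C -> y \in C ->
    x != y -> #|nbhd x :&: W| + #|nbhd y :&: W| <= #|W|.
  move=> hC xC yC xy; rewrite -cardsUI.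
  have -> : (nbhd x :&: W) :&: (nbhd y :&: W) = set0.
    apply/setP => u; rewrite !in_setI in_set0; apply/negP => /andP[/andP[xu uW] /andP[yu _]].
    have /eqP := hC u uW; rewrite eqn_leq => /andP[/card_le1_eqP h _].
    by move: xu yu; rewrite !inE => xu yu; case/eqP: xy; apply: h; rewrite !inE esym ?xu ?yu.
  rewrite cards0 addn0 subset_leq_card // subUset !subsetIr //.
have single (C : {set V}) c : c \in C -> ~~ [exists x, (x != c) && (x \in C)] -> C = [set c].
  move=> cC; rewrite negb_exists => /forallP h; apply/setP => x; rewrite inE.
  by apply/idP/eqP => [xC|-> //]; have := h x; rewrite xC andbT negbK => /eqP.
have one (c d : V) : e v c -> e v d -> c != d -> ~~ e c d ->
    (forall u, u \in W -> #|nbhd u :&: K c| = 1) ->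
    (forall u, u \in W -> #|nbhd u :&: K d| = 1) ->
    (forall x y, x \in K c -> y \in K d -> 1 + #|W| <= #|nbhd x :&: W| + #|nbhd y :&: W|) ->
    #|V| = 1 + #|K c| + #|K d| + #|W| -> K d = [set d] -> is_C4.
  move=> vc vd cd ncd Wc Wd h cVd Kd.
  have dK : d \in K d by rewrite Kd set11.
  have cK : c \in K c by rewrite inE vc eqxx.
  apply: (@pendant_C4 v c d (K c)) => //.
  - exact: Kcl.
  - exact: Kv.
  - by move=> x xc; apply: (Ksep c d).
  - move=> u /Wd /eqP /cards1P[y]; rewrite Kd => /setP/(_ y); rewrite !inE eqxx.
    by case/andP=> uy /eqP <-.
  - move=> x y xW yW xy; have [_ _ /setP/(_ y)] := Wu x xW.
    by rewrite !in_setI yW in_setD1 eq_sym xy yW !inE andbT => ->.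
  - move=> x xc; have h1 := h x d xc dK.
    have : 0 < #|nbhd x :&: W|.
      have := subset_leq_card (subsetIr (nbhd d) W); move: h1; clear; lia.
    by case/card_gt0P => u; rewrite in_setI inE => /andP[xu uW]; exists u.
  - by rewrite cVd Kd cards1; rewrite -/W; clear; lia.
have WA u : u \in W -> #|nbhd u :&: A| = 1 by case/Wu.
have WB u : u \in W -> #|nbhd u :&: B| = 1 by case/Wu.
have [/existsP[x /andP[xa xA]]|nA] := boolP [exists x, (x != a) && (x \in A)]; last first.
  apply: (one b a) => //; last exact: single nA.
    by move=> x y xB yA; rewrite addnC [X in _ <= X]addnC addnC AB.
  by rewrite cV -/A -/B; clear; lia.
have [/existsP[y /andP[yb yB]]|nB] := boolP [exists x, (x != b) && (x \in B)]; last first.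
  by apply: (one a b) => //; exact: single nB.
(* With two vertices in each clique, [AB] for two disjoint pairs yields at least [2 + 2|W|] edges to
   [W], but [dis] allows at most [2|W|]. *)
have := dis A x a WA xA aA xa; have := dis B y b WB yB bB yb.
have := AB a b aA bB; have := AB x y xA yB; clear; lia.
Qed.

(** * Lines and the weights of vertices *)

(** For an edge [ab] this is the unique maximal clique containing it, since common neighbours of [a]
    and [b] are adjacent by [diamond_adj]. *)
Definition line a b := [set x | [|| x == a, x == b | e x a && e x b]].

Lemma line_clique a b : e a b -> clique (line a b).
Proof.
move=> ab x y; rewrite !inE.
case/or3P=> [/eqP->|/eqP->|/andP[xa xb]] /or3P[/eqP->|/eqP->|/andP[ya yb]] // xy;
  rewrite ?eqxx // ?(esym a y) ?(esym b y) ?(esym b a) // in xy *.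
by apply: (@diamond_adj a b).
Qed.

(** Lines behave as in a linear space: a common neighbour of two points of a line is adjacent to
    every other point of it, again by diamonds. *)
Lemma lineE a b x y :
  e a b -> x \in line a b -> y \in line a b -> x != y -> line a b = line x y.
Proof.
move=> ab xab yab xy; have exy := line_clique ab xab yab xy.
apply/setP => z; apply/idP/idP => [zab|].
  rewrite inE; have [//|zx /=] := eqVneq z x; have [//|zy /=] := eqVneq z y.
  by rewrite !(line_clique ab).
rewrite inE; case/or3P=> [/eqP->|/eqP->|/andP[zx zy]] //; rewrite inE.
have adj c : c \in line a b -> z != c -> e z c.
  move=> cab zc; have [<-//|xc] := eqVneq x c; have [<-//|yc] := eqVneq y c.
  apply: (@diamond_adj x y) => //; rewrite (line_clique ab) 1?eq_sym //.
have [//|za /=] := eqVneq z a; have [//|zb /=] := eqVneq z b.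
by rewrite !adj // inE eqxx ?orbT.
Qed.

Definition lines := [set line p.1 p.2 | p : V * V & e p.1 p.2].

Lemma linesP A : reflect (exists a b, e a b /\ A = line a b) (A \in lines).
Proof.
apply: (iffP imsetP) => [[[a b]]|[a [b [ab ->]]]]; first by rewrite inE /= => ab ->; exists a, b.
by exists (a, b) => //; rewrite inE.
Qed.

(** Indexing by all vertex sets, with the empty set in place of non-lines, keeps the index type
    finite and adds nothing to the sum. *)
Definition line_fam (A : {set V}) := if A \in lines then A else set0.

Lemma mem_line_fam A x : (x \in line_fam A) = (A \in lines) && (x \in A).
Proof. by rewrite /line_fam; case: ifP => //; rewrite inE. Qed.

Lemma sum_lines : \sum_A (#|line_fam A|.*2 - 3) <= f setT.
Proof.
apply: line_rank => [A|A x y|A B x a b].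
- exact: subsetT.
- rewrite !mem_line_fam => /andP[/linesP[a [b [ab ->]]] xA] /andP[_ yA].
  exact: (line_clique ab).
rewrite !mem_line_fam => AB /andP[Al xA] /andP[Bl xB] /andP[_ aA] /andP[_ bB] ax bx.
have [p [q [pq Apq]]] := linesP _ Al; have [r [s [rs Brs]]] := linesP _ Bl.
move: AB; rewrite Apq Brs in xA aA xB bB * => AB.
rewrite eq_sym in ax; rewrite eq_sym in bx.
have Axa := lineE pq xA aA ax; have Bxb := lineE rs xB bB bx.
(* If [a] and [b] were equal or adjacent, the two lines through [x] would coincide. *)
apply/andP; split; first by apply: contraNneq AB => ab; rewrite Axa Bxb ab.
apply: contraNN AB => ab; rewrite Bxb; apply/eqP; apply: lineE => //.
by rewrite Axa inE esym (line_clique rs) // esym ab !orbT.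
Qed.

Local Open Scope ring_scope.

(* Each line spreads its contribution [2|L| - 3] evenly over its vertices. *)
Definition vertex_weight v := \sum_(A | v \in line_fam A) line_weight #|line_fam A|.

Lemma vertex_weight_ge (s : seq {set V}) v :
  uniq s -> (forall A, A \in s -> v \in line_fam A) ->
  \sum_(A <- s) line_weight #|A| <= vertex_weight v.
Proof.
move=> us sv; rewrite big_uniq //= /vertex_weight [leRHS](bigID (mem s)) /=.
have -> : \sum_(A | (v \in line_fam A) && (A \in s)) line_weight #|line_fam A| =
    \sum_(A in s) line_weight #|A|.
  apply: eq_big => [A|A /andP[+ _]]; first by apply/andP/idP => [[]|As] //; split=> //; exact: sv.
  by rewrite mem_line_fam /line_fam => /andP[-> _].
rewrite lerDl; apply: sumr_ge0 => A _; exact: line_weight_ge0.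
Qed.

(** The lines through [a], [b] and [c] are distinct and weigh at least 1/2 each. A fourth neighbour
    lies on one of them, which then weighs at least 1, or starts a fourth line. *)
Lemma independent_weight v a b c :
  e v a -> e v b -> e v c -> uniq [:: a; b; c] -> ~~ e a b -> ~~ e a c -> ~~ e b c ->
  (2%:R - (#|nbhd v| == 3%N)%:R / 2%:R <= vertex_weight v) /\ (2 < #|nbhd v|)%N.
Proof.
move=> va vb vc; rewrite /= !inE negb_or andbT => /andP[/andP[nab nac] nbc] ab ac bc.
have lv x : e v x -> v \in line_fam (line v x).
  by move=> vx; rewrite mem_line_fam inE eqxx andbT; apply/linesP; exists v, x.
have mem2 x : x \in line v x by rewrite inE eqxx orbT.
have ldif x y : e v x -> x != y -> ~~ e x y -> line v x != line v y.
  move=> vx xy; apply: contraNneq => l.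
  by apply: (line_clique vx) => //; rewrite l.
have card2 x y : e v x -> x != y -> e v y -> e x y -> (2 < #|line v x|)%N.
  move=> vx xy vy exy; apply/card_gt2P; exists v, x, y; split.
    by rewrite !inE !eqxx ?orbT (esym y v) (esym y x) vy exy ?orbT.
  by rewrite (adj_neq vx) xy eq_sym (adj_neq vy).
have w x : e v x -> 1 / 2%:R <= line_weight #|line v x|.
  move=> vx; apply: line_weight_half; apply/card_gt1P; exists v, x.
  by rewrite mem2 inE eqxx (adj_neq vx).
have Nge : (2 < #|nbhd v|)%N.
  by apply/card_gt2P; exists a, b, c; rewrite !inE va vb vc nab nbc eq_sym nac.
split=> //.
have three : uniq [:: line v a; line v b; line v c].
  by rewrite /= !inE negb_or !ldif.
have [[wa wb] wc] := (w a va, w b vb, w c vc).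
have fam3 A : A \in [:: line v a; line v b; line v c] -> v \in line_fam A.
  by rewrite !inE => /or3P[] /eqP ->; exact: lv.
have := vertex_weight_ge three fam3; rewrite !big_cons big_nil => h3.
case: eqP => [_|/eqP N3]; rewrite ?mulr1n ?mul0r ?subr0; first by lra.
have [d] : exists d, d \in nbhd v :\ a :\ b :\ c.
  apply/card_gt0P; move: Nge N3; rewrite (cardsD1 a) (cardsD1 b (nbhd v :\ a)).
  rewrite (cardsD1 c (nbhd v :\ a :\ b)) !inE va vb vc (eq_sym b) nab.
  by rewrite (eq_sym c b) (eq_sym c a) nac nbc; clear; case: #|_|.
rewrite !inE => /and4P[dc db da vd].
have big1_ x : e v x -> x != d -> e x d -> 1 <= line_weight #|line v x|.
  by move=> vx xd exd; apply/line_weight1/(card2 x d).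
have [ad|ad] := boolP (e a d).
  by have := big1_ a va; rewrite eq_sym => /(_ da ad); lra.
have [bd|bd] := boolP (e b d).
  by have := big1_ b vb; rewrite eq_sym => /(_ db bd); lra.
have [cd|cd] := boolP (e c d).
  by have := big1_ c vc; rewrite eq_sym => /(_ dc cd); lra.
have four : uniq [:: line v d; line v a; line v b; line v c].
  by rewrite /= -/(uniq [:: line v a; line v b; line v c]) three andbT !inE !negb_or !ldif // esym.
have fam4 A : A \in [:: line v d; line v a; line v b; line v c] -> v \in line_fam A.
  by rewrite inE => /orP[/eqP->|/fam3 //]; exact: lv.
have := vertex_weight_ge four fam4; rewrite !big_cons big_nil.
by have := w d vd; lra.
Qed.

Local Close Scope ring_scope.

Definition independent_triple v := [exists a, exists b, exists c,
  [&& e v a, e v b, e v c, uniq [:: a; b; c], ~~ e a b, ~~ e a c & ~~ e b c]].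

Lemma independent_triples_rank :
  (forall v, independent_triple v) -> #|V|.*2 - 3 <= f setT.
Proof.
move=> ind.
have wt v : ((2%:R - (#|nbhd v| == 3%N)%:R / 2%:R <= vertex_weight v) /\ (2 < #|nbhd v|)%N)%R.
  have /existsP[a /existsP[b /existsP[c /and5P[va vb vc U /and3P[ab ac bc]]]]] := ind v.
  exact: (independent_weight va vb vc U).
have [//|small] := leqP.
pose T := [set v | #|nbhd v| == 3].
have sumw : (2%:R * #|V|%:R - #|T|%:R / 2%:R <= (f setT)%:R :> rat)%R.
  apply: (@le_trans _ _ (\sum_(A : {set V}) (#|line_fam A|.*2 - 3))%:R%R); last first.
    by rewrite ler_nat sum_lines.
  rewrite -(sum_line_weight (S := setT)) => [|A]; last exact: subsetT.
  apply: (@le_trans _ _ (\sum_(v in [set: V]) (2%:R - (#|nbhd v| == 3%N)%:R / 2%:R))%R).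
    rewrite big_split /= sumr_const cardsT mulr_natr sumrN -mulr_suml lerD2l lerN2.
    rewrite ler_pM2r ?invr_gt0 ?ltr0n // -natr_sum ler_nat -big_mkcondr sum1_card.
    by rewrite subset_leq_card //; apply/subsetP => v; rewrite unfold_in !inE.
  by apply: ler_sum => v _; have [] := wt v.
(* A deficient rank is at most [2|V| - 4], so the halves lost at vertices of degree 3 add up to at
   least 4. *)
have T8 : 8 <= #|T|.
  rewrite -(ler_nat rat); have : ((f setT)%:R + 4%:R <= #|V|%:R * 2%:R :> rat)%R.
    by rewrite -natrM -natrD ler_nat; lia.
  by move: sumw; lra.
have [v vT] : exists v, v \in T by apply/card_gt0P; lia.
(* At most four vertices of [T] lie in the closed neighbourhood of [v]. A vertex [u] outside it
   gives degree sum 6, less than [8 <= |V|]. *)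
have [u] : exists u, u \in T :\: (v |: nbhd v).
  apply/card_gt0P; have := cardsID (v |: nbhd v) T.
  have := subset_leq_card (subsetIr T (v |: nbhd v)).
  by rewrite cardsU1; move: vT; rewrite inE => /eqP ->; lia.
rewrite !inE negb_or => /andP[/andP[uv nvu] /eqP uT].
have := ore uv; rewrite esym => /(_ nvu); rewrite uT.
have cT : #|T| <= #|V| by exact: max_card.
by move: vT T8 cT; rewrite inE => /eqP ->; clear; lia.
Qed.

Theorem ore_rank : #|V|.*2 - 3 <= f setT \/ is_C4.
Proof.
have [/forallP ind|] := boolP [forall v, independent_triple v].
  by left; exact: independent_triples_rank.
rewrite negb_forall => /existsP[v nind].
(* Without an independent triple, any two non-adjacent neighbours of [v] dominate the whole
   neighbourhood. *)
have [/existsP[a /existsP[b /and4P[va vb ab nab]]]|ncl] :=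
    boolP [exists a, exists b, [&& e v a, e v b, a != b & ~~ e a b]]; last first.
  left; apply: (@clique_nbhd_complete v) => x y; rewrite !inE => vx vy xy.
  apply: contraNT ncl => nxy; apply/existsP; exists x; apply/existsP; exists y.
  by rewrite vx vy xy nxy.
right; apply: (two_cliques_C4 va vb ab nab) => x vx.
apply: contraNT nind; rewrite !negb_or => /and4P[xa xb nax nbx].
apply/existsP; exists a; apply/existsP; exists b; apply/existsP; exists x.
by rewrite va vb vx nab nax nbx /= !inE negb_or ab eq_sym xa eq_sym xb.
Qed.

End RankTheory.

(** * Ranks, minors and block matrices *)

Local Open Scope ring_scope.
Local Notation R := Rdefinitions.R.

Section Rank.
Variable F : fieldType.

(** Rank is expressed by a nonzero minor because determinants are polynomial, and continuous, in the
    entries. *)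
Lemma rank_minor m n (A : 'M[F]_(m, n)) :
  exists f : 'I_(\rank A) -> 'I_m, exists g : 'I_(\rank A) -> 'I_n,
    \det (mxsub f g A) != 0.
Proof.
set B := rowsub (maxrankfun A) A.
have Bfull : row_full B^T.
  by rewrite /row_full mxrank_tr; exact: maxrowsub_free.
exists (maxrankfun A), (fullrankfun Bfull).
have := fullrowsub_unit Bfull; rewrite unitmxE unitfE -det_tr trmx_mxsub trmxK.
by rewrite -mxsubcr.
Qed.

Lemma minor_rank m n r (f : 'I_r -> 'I_m) (g : 'I_r -> 'I_n) (A : 'M[F]_(m, n)) :
  \det (mxsub f g A) != 0 -> (r <= \rank A)%N.
Proof.
rewrite -unitfE -unitmxE => /mxrank_unit <-.
rewrite -[A in mxsub f g A]mulmx1 mxsub_mul (leq_trans (mxrankM_maxl _ _)) //.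
by rewrite -[A in rowsub f A]mul1mx mxsub_mul mxsub_id mxrankM_maxr.
Qed.

(** The image of the row space under [P] has dimension at least [k], and [U] lies in the kernel;
    rank-nullity adds the two. *)
Lemma rank_add_block m k p N q (U : 'M[F]_(m, N)) (C : 'M_(k, N)) (A : 'M_(p, N))
    (P : 'M_(N, q)) :
  U *m P = 0 -> row_free (C *m P) -> (U <= A)%MS -> (C <= A)%MS ->
  (\rank U + k <= \rank A)%N.
Proof.
move=> UP CP UA CA; rewrite -(mxrank_mul_ker A P) addnC leq_add //.
  by rewrite -(eqP CP) mxrankS // submxMr.
by rewrite mxrankS // sub_capmx UA; apply/sub_kermxP.
Qed.

Lemma row_free_rV n (u : 'rV[F]_n) k : u 0 k != 0 -> row_free u.
Proof.
move=> uk; rewrite /row_free rank_rV (_ : u != 0) //.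
by apply: contraNneq uk => ->; rewrite mxE.
Qed.

Lemma det_mx22 (M : 'M[F]_2) : \det M = M 0 0 * M 1 1 - M 0 1 * M 1 0.
Proof.
rewrite (expand_det_row _ 0) !big_ord_recl big_ord0 /cofactor !det_mx11 !mxE.
rewrite (_ : lift 0 0 = 1); last exact/val_inj.
rewrite (_ : lift 1 0 = 0); last exact/val_inj.
by rewrite /= expr0 expr1; ring.
Qed.

Lemma row_free_col2 (u v : 'rV[F]_2) :
  u 0 0 * v 0 1 - u 0 1 * v 0 0 != 0 -> row_free (col_mx u v).
Proof.
move=> uv; rewrite row_free_unit unitmxE unitfE.
have E0 k : (col_mx u v : 'M_2) (0 : 'I_2) k = u 0 k.
  by rewrite -(col_mxEu u v 0 k); congr (col_mx _ _ _ _); exact/val_inj.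
have E1 k : (col_mx u v : 'M_2) (1 : 'I_2) k = v 0 k.
  by rewrite -(col_mxEd u v 0 k); congr (col_mx _ _ _ _); exact/val_inj.
by rewrite (det_mx22 (col_mx u v)) !E0 !E1.
Qed.

End Rank.

(** * The rigidity matrix *)

Section RigidityMatrix.
Variables (K : comNzRingType) (n : nat).
Implicit Types (X : 'M[K]_(n, 2)) (e : rel 'I_n).

Definition rig_row X (i j : 'I_n) : 'rV[K]_(n * 2) :=
  mxvec (\matrix_(l, k) (((l == i)%:R - (l == j)%:R) * (X i k - X j k))).

(** All ordered pairs index rows, with zero rows for non-edges, so the size does not depend on the
    graph. *)
Definition rig_mx X e : 'M[K]_(#|{: 'I_n * 'I_n}|, n * 2) :=
  \matrix_p (let ij := enum_val p in if e ij.1 ij.2 then rig_row X ij.1 ij.2 else 0).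

(** As a functional of [D], the row is half the derivative of the squared distance of [i] and
    [j]. *)
Lemma rig_row_dot X i j (D : 'M[K]_(n, 2)) :
  (rig_row X i j *m (mxvec D)^T) 0 0 = \sum_k (X i k - X j k) * (D i k - D j k).
Proof.
transitivity (\sum_k \sum_l ((l == i)%:R - (l == j)%:R) * (X i k - X j k) * D l k).
  rewrite mxE (reindex _ (curry_mxvec_bij _ _)) /= exchange_big pair_bigA /=.
  by apply: eq_bigr => -[l k] _ /=; rewrite !mxE !mxvecE mxE.
apply: eq_bigr => k _.
have pick x : \sum_(l < n) (l == x)%:R * D l k = D x k.
  rewrite (bigD1 x) //= eqxx mul1r big1 ?addr0 // => l /negPf ->.
  by rewrite mul0r.
rewrite -(pick i) -(pick j) -sumrB mulr_sumr; apply: eq_bigr => l _.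
by ring.
Qed.

Lemma rig_row_sym X i j : rig_row X i j = rig_row X j i.
Proof. by congr mxvec; apply/matrixP => l k; rewrite !mxE; ring. Qed.

Lemma eq_rig_row X Y i j : row i X = row i Y -> row j X = row j Y ->
  rig_row X i j = rig_row Y i j.
Proof.
move=> /rowP iE /rowP jE; congr mxvec; apply/matrixP => l k.
by have := iE k; have := jE k; rewrite !mxE => -> ->.
Qed.

(** The projection onto the two columns of [v]. *)
Definition coord_mx (v : 'I_n) : 'M[K]_(n * 2, 2) :=
  \matrix_(q, k) (q == mxvec_index v k)%:R.

Lemma rig_row_coord X i j v :
  rig_row X i j *m coord_mx v = ((v == i)%:R - (v == j)%:R) *: (row i X - row j X).
Proof.
apply/rowP => k; rewrite mxE (bigD1 (mxvec_index v k)) //= !mxE eqxx mulr1.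
rewrite big1 ?addr0 => [|q /negPf qv]; last by rewrite !mxE qv mulr0.
by rewrite mxvecE !mxE.
Qed.

Definition induced e (S : {set 'I_n}) : rel 'I_n :=
  fun i j => [&& e i j, i \in S & j \in S].

End RigidityMatrix.

Lemma map_rig_mx (K K' : comNzRingType) (g : {rmorphism K -> K'}) n
    (X : 'M[K]_(n, 2)) (e : rel 'I_n) :
  map_mx g (rig_mx X e) = rig_mx (map_mx g X) e.
Proof.
apply/matrixP => p q; rewrite !mxE /=; case: (e _ _); last by rewrite !mxE rmorph0.
case: (mxvec_indexP q) => l k; rewrite !mxvecE !mxE.
by rewrite rmorphM !rmorphB !rmorph_nat.
Qed.

(** * Adding a vertex *)

Section RigidityRank.
Variables (F : fieldType) (n : nat).
Implicit Types (X : 'M[F]_(n, 2)) (e : rel 'I_n).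

Lemma rig_mx_subP X e m (B : 'M[F]_(m, n * 2)) :
  reflect (forall i j, e i j -> (rig_row X i j <= B)%MS) (rig_mx X e <= B)%MS.
Proof.
apply: (iffP row_subP) => [h i j ij|h p]; last first.
  by rewrite rowK /=; case eij: (e _ _); [exact: h | exact: sub0mx].
by have := h (enum_rank (i, j)); rewrite rowK enum_rankK /= ij.
Qed.

Lemma rig_row_sub X e i j : e i j -> (rig_row X i j <= rig_mx X e)%MS.
Proof. by move=> ij; have /rig_mx_subP := submx_refl (rig_mx X e); apply. Qed.

Lemma rig_mxS X e e' : subrel e e' -> (rig_mx X e <= rig_mx X e')%MS.
Proof. by move=> ee; apply/rig_mx_subP => i j /ee; exact: rig_row_sub. Qed.

Lemma inducedS e (S T : {set 'I_n}) :
  S \subset T -> subrel (induced e S) (induced e T).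
Proof.
move=> /subsetP ST i j /and3P[ij iS jS].
by apply/and3P; split; rewrite ?ST.
Qed.

Lemma induced_coord0 X e (S : {set 'I_n}) v :
  v \notin S -> rig_mx X (induced e S) *m coord_mx F v = 0.
Proof.
move=> vS; apply/sub_kermxP/rig_mx_subP => i j /and3P[_ iS jS]; apply/sub_kermxP.
rewrite rig_row_coord.
have -> : (v == i) = false by apply: contraNF vS => /eqP ->.
have -> : (v == j) = false by apply: contraNF vS => /eqP ->.
by rewrite subr0 scale0r.
Qed.

Lemma rig_row_coordE X v a : v != a ->
  rig_row X v a *m coord_mx F v = row v X - row a X.
Proof. by move=> /negPf va; rewrite rig_row_coord eqxx va subr0 scale1r. Qed.

(** Twice the signed area of the triangle [abc]. *)
Definition orient X (a b c : 'I_n) : F :=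
  (X a 0 - X b 0) * (X a 1 - X c 1) - (X a 1 - X b 1) * (X a 0 - X c 0).

Lemma rank_add_neighbour X e e' (S : {set 'I_n}) v a k :
  v \notin S -> a \in S -> subrel (induced e S) e' -> e' v a -> X v k != X a k ->
  (\rank (rig_mx X (induced e S)) < \rank (rig_mx X e'))%N.
Proof.
move=> vS aS sub va Xva; rewrite -addn1.
have nva : v != a by apply: contraNneq vS => ->.
apply: (rank_add_block (induced_coord0 X e vS) (C := rig_row X v a)).
- by rewrite rig_row_coordE // (@row_free_rV _ _ _ k) // !mxE subr_eq0.
- exact: rig_mxS.
- exact: rig_row_sub.
Qed.

(** This is 0-extension: the old rows vanish on the columns of [v], where the two new rows are
    independent. *)
Lemma rank_add_neighbours X e e' (S : {set 'I_n}) v a b :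
  v \notin S -> a \in S -> b \in S -> subrel (induced e S) e' -> e' v a -> e' v b ->
  orient X v a b != 0 ->
  (\rank (rig_mx X (induced e S)) + 2 <= \rank (rig_mx X e'))%N.
Proof.
move=> vS aS bS sub va vb Xvab.
have nva : v != a by apply: contraNneq vS => ->.
have nvb : v != b by apply: contraNneq vS => ->.
apply: (rank_add_block (induced_coord0 X e vS)
          (C := col_mx (rig_row X v a) (rig_row X v b))).
- rewrite mul_col_mx !rig_row_coordE //; apply: row_free_col2.
  by rewrite !mxE.
- exact: rig_mxS.
- by rewrite col_mx_sub !rig_row_sub.
Qed.

End RigidityRank.

(** * The upper bound on the rank *)

Section RankBound.
Variables (F : fieldType) (n : nat).
Implicit Types (X : 'M[F]_(n, 2)) (e : rel 'I_n).

(** The two translations and the infinitesimal rotation about the origin. *)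
Definition trivial_motion X (r : 'I_3) : 'M[F]_(n, 2) :=
  \matrix_(i, k) [:: (k == 0)%:R; (k == 1)%:R; if k == 0 then - X i 1 else X i 0]`_r.

Lemma trivial_motion_dot X r i j :
  rig_row X i j *m (mxvec (trivial_motion X r))^T = 0.
Proof.
apply/matrixP => p q; rewrite !ord1 rig_row_dot !big_ord_recl big_ord0 !mxE.
rewrite (_ : lift 0 0 = 1); last exact/val_inj.
by case: r => [[|[|[|//]]] ?] /=; rewrite ?eqxx /=; ring.
Qed.

(** The three trivial motions lie in the kernel and are independent unless all points coincide, in
    which case the matrix is zero. *)
Lemma rank_rig_mx X e : (1 < n)%N -> (\rank (rig_mx X e) <= n.*2 - 3)%N.
Proof.
move=> n1.
have [/existsP[a /existsP[b /existsP[k Xab]]]|same] :=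
    boolP [exists a, exists b, exists k, X a k != X b k]; last first.
  suff -> : rig_mx X e = 0 by rewrite mxrank0.
  apply/eqP; rewrite -submx0; apply/rig_mx_subP => i j _.
  rewrite submx0; apply/eqP; rewrite -[RHS](linear0 mxvec); congr mxvec.
  apply/matrixP => l k; rewrite !mxE; have [->|Xij] := eqVneq (X i k) (X j k).
    by rewrite subrr mulr0.
  by case/negP: same; apply/existsP; exists i; apply/existsP; exists j; apply/existsP; exists k.
pose B : 'M[F]_(3, n * 2) := \matrix_r mxvec (trivial_motion X r).
have AB : rig_mx X e *m B^T = 0.
  apply/trmx_inj; rewrite trmx_mul trmxK trmx0; apply/row_matrixP => r.
  rewrite row_mul rowK row0; apply/trmx_inj; rewrite trmx_mul trmxK trmx0.
  apply/sub_kermxP/rig_mx_subP => i j _; apply/sub_kermxP; exact: trivial_motion_dot.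
have Bfree : row_free B.
  apply: inj_row_free => u uB.
  have eqs (i : 'I_n) (c : 'I_2) : u 0 0 * (c == 0)%:R + u 0 1 * (c == 1)%:R +
     u 0 2%:R * (if c == 0 then - X i 1 else X i 0) = 0.
    have /rowP/(_ (mxvec_index i c)) := uB; rewrite !mxE !big_ord_recl big_ord0.
    rewrite !mxE !mxvecE !mxE /= addr0 addrA => <-.
    by do !congr (_ + _ * _); congr (u _ _); apply/val_inj.
  have a0 := eqs a 0; have b0 := eqs b 0; have a1 := eqs a 1; have b1 := eqs b 1.
  rewrite /= in a0 b0 a1 b1.
  (* Comparing two points that differ in coordinate [k] cancels the translations and leaves the
     rotation. *)
  have u2 : u 0 2%:R = 0.
    have : u 0 2%:R * (X a k - X b k) = 0.
      case: k Xab => [[|[|//]] kP] Xab.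
        rewrite (_ : Ordinal kP = 0) in Xab *; last exact/val_inj.
        by rewrite -[RHS](subrr 0) -{1}a1 -b1; ring.
      rewrite (_ : Ordinal kP = 1) in Xab *; last exact/val_inj.
      by rewrite -[RHS](subrr 0) -{1}b0 -a0; ring.
    by move/eqP; rewrite mulf_eq0 subr_eq0 (negPf Xab) orbF => /eqP.
  rewrite u2 in a0 a1.
  apply/rowP => c; rewrite mxE; case: c => [[|[|[|//]]] cP].
  - by rewrite (_ : Ordinal cP = 0); [rewrite -a0; ring|exact/val_inj].
  - by rewrite (_ : Ordinal cP = 1); [rewrite -a1; ring|exact/val_inj].
  - by rewrite (_ : Ordinal cP = 2%:R); [|exact/val_inj].
have := mulmx0_rank_max AB; rewrite mxrank_tr (eqP Bfree); lia.
Qed.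

End RankBound.

(** * Generic frameworks *)

Section Generic.
Variable n : nat.
Implicit Types (X Y : framework n) (e : rel 'I_n).

Definition eval_at X : {mpoly rat[n * 2]} -> R :=
  meval (fun k => mxvec X 0 k) \o map_mpoly (ratr : rat -> R).

HB.instance Definition _ X := GRing.RMorphism.on (eval_at X).

Definition coord_poly : 'M[{mpoly rat[n * 2]}]_(n, 2) :=
  \matrix_(i, k) 'X_(mxvec_index i k).

Lemma eval_coord X i k : eval_at X (coord_poly i k) = X i k.
Proof. by rewrite mxE /eval_at /= map_mpolyX mevalXU mxvecE. Qed.

Lemma map_coord_poly X : map_mx (eval_at X) coord_poly = X.
Proof. by apply/matrixP => i k; rewrite mxE eval_coord. Qed.

(** Generic non-vanishing is thus proved by exhibiting one special position. *)
Lemma generic_neq0 X Y P : generic X -> eval_at Y P != 0 -> eval_at X P != 0.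
Proof.
move=> gX YP; apply: gX; apply: contraNneq YP => ->.
by rewrite rmorph0.
Qed.

(** A nonzero minor at [Y] is a rational polynomial that cannot vanish at [X]. *)
Lemma generic_rank X Y e :
  generic X -> (\rank (rig_mx Y e) <= \rank (rig_mx X e))%N.
Proof.
move=> gX; have [f [g fg]] := rank_minor (rig_mx Y e).
pose P := \det (mxsub f g (rig_mx coord_poly e)).
have evP Z : eval_at Z P = \det (mxsub f g (rig_mx Z e)).
  by rewrite -det_map_mx map_mxsub map_rig_mx map_coord_poly.
by apply: (minor_rank (f := f) (g := g)); rewrite -evP (generic_neq0 (Y := Y)) ?evP.
Qed.

Lemma generic_orient X a b c :
  generic X -> a != b -> a != c -> b != c -> orient X a b c != 0.
Proof.
move=> gX ab ac bc.
pose P := (coord_poly a 0 - coord_poly b 0) * (coord_poly a 1 - coord_poly c 1) -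
  (coord_poly a 1 - coord_poly b 1) * (coord_poly a 0 - coord_poly c 0).
have evP Z : eval_at Z P = orient Z a b c.
  by rewrite /P rmorphB !rmorphM !rmorphB /= !eval_coord.
(* This puts [b] at (1,0), [c] at (0,1) and everything else at the origin. *)
pose Y : framework n := \matrix_(i, k) (i == if k == 0 then b else c)%:R.
rewrite -evP (generic_neq0 (Y := Y)) // evP /orient !mxE /= !eqxx.
rewrite (negPf ab) (negPf ac) (negPf bc) (eq_sym c b) (negPf bc) !sub0r mulrNN mulr1.
by rewrite oppr0 mul0r subr0 oner_neq0.
Qed.

Lemma generic_neq X a b : generic X -> a != b -> X a 0 != X b 0.
Proof.
move=> gX ab; pose Y : framework n := \matrix_(i, k) (i == a)%:R.
have evP Z : eval_at Z (coord_poly a 0 - coord_poly b 0) = Z a 0 - Z b 0.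
  by rewrite rmorphB /= !eval_coord.
rewrite -subr_eq0 -evP (generic_neq0 (Y := Y)) // evP !mxE eqxx (eq_sym b a) (negPf ab).
by rewrite subr0 oner_neq0.
Qed.

(* Moving [v] to the midpoint of [a] and [b] puts the row of [ab] in the span of
   the rows of [va] and [vb]; a special position has at most the generic rank. *)
Lemma generic_one_extension X e (S : {set 'I_n}) v a b c :
  generic X -> v \notin S -> a \in S -> b \in S -> c \in S ->
  a != b -> a != c -> b != c -> e v a -> e v b -> e v c ->
  ~~ (rig_row X a b <= rig_mx X (induced e S))%MS ->
  (\rank (rig_mx X (induced e S)) + 3 <= \rank (rig_mx X (induced e (v |: S))))%N.
Proof.
move=> gX vS aS bS cS ab ac bc va vb vc nab.
have neq x : x \in S -> x != v by move=> xS; apply: contraNneq vS => <-.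
pose Y : framework n :=
  \matrix_(i, k) if i == v then (X a k + X b k) / 2%:R else X i k.
have YE i : i \in S -> row i Y = row i X.
  by move=> /neq/negPf iv; apply/rowP => k; rewrite !mxE iv.
have rowE i j : i \in S -> j \in S -> rig_row X i j = rig_row Y i j.
  by move=> iS jS; apply: eq_rig_row; rewrite YE.
apply: leq_trans (generic_rank Y _ gX).
set U := rig_mx X (induced e S); set W := rig_mx Y _.
have UE : U = rig_mx Y (induced e S).
  apply/row_matrixP => p; rewrite !rowK /=.
  case ij: (induced e S (enum_val p).1 (enum_val p).2) => //.
  by have /and3P[_ iS jS] := ij; exact: rowE.
have ext i j : i = v -> j \in S -> e v j -> (rig_row Y i j <= W)%MS.
  by move=> -> jS vj; apply: rig_row_sub; rewrite /induced vj !inE eqxx jS orbT.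
have mid : rig_row Y a b = 2%:R *: (rig_row Y v a + rig_row Y v b).
  rewrite /rig_row -linearD -linearZ; congr mxvec; apply/matrixP => l k; rewrite !mxE eqxx.
  by rewrite (negPf (neq a aS)) (negPf (neq b bS)); field.
have abW : (rig_row Y a b <= W)%MS.
  by rewrite mid scalemx_sub // addmx_sub ?ext.
(* Of the three units gained, the row of [ab] gives the first; the rows of [vb] and [vc] give two
   more on the columns of [v]. *)
have rk1 : (\rank U + 1 <= \rank (col_mx U (rig_row X a b)))%N.
  rewrite addn1; apply: rank_ltmx; rewrite ltmxE col_mx_sub submx_refl /=.
  by rewrite -addsmxE addsmxSl nab.
rewrite (_ : 3 = 1 + 2)%N // addnA; apply: leq_trans (leq_add rk1 (leqnn 2)) _.
apply: (rank_add_block (C := col_mx (rig_row Y v b) (rig_row Y v c)) (P := coord_mx _ v)).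
- rewrite mul_col_mx {1}/U induced_coord0 // rig_row_coord.
  by rewrite !(eq_sym v) (negPf (neq a aS)) (negPf (neq b bS)) subrr scale0r col_mx0.
- rewrite mul_col_mx !rig_row_coordE 1?eq_sym ?neq //; apply: row_free_col2.
  rewrite !mxE eqxx (negPf (neq b bS)) (negPf (neq c cS)).
  (* The midpoint of [ab] with [b] and [c] spans half the area of [abc]. *)
  have := generic_orient gX ab ac bc; apply: contraNneq => h.
  by apply/eqP; rewrite -[RHS](mulr0 2%:R) -{}h /orient; field.
- rewrite col_mx_sub UE rig_mxS ?(rowE a b) //; apply: inducedS; exact: subsetUr.
- by rewrite col_mx_sub !ext.
Qed.

Definition set_rank X e (S : {set 'I_n}) := \rank (rig_mx X (induced e S)).

Lemma set_rank_add2 X e (S : {set 'I_n}) v a b :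
  generic X -> v \notin S -> a \in S -> b \in S -> a != b -> e v a -> e v b ->
  (set_rank X e S + 2 <= set_rank X e (v |: S))%N.
Proof.
move=> gX vS aS bS ab va vb.
apply: (rank_add_neighbours vS aS bS).
- by apply: inducedS; exact: subsetUr.
- by rewrite /induced va !inE eqxx aS orbT.
- by rewrite /induced vb !inE eqxx bS orbT.
by apply: generic_orient => //; apply: contraNneq vS => ->.
Qed.

(** The bound for the full vertex set descends to [S]: in a complete graph each further vertex adds
    at least 2 to the rank. *)
Lemma set_rank_le X e (S : {set 'I_n}) :
  generic X -> (1 < #|S|)%N -> (set_rank X e S <= #|S|.*2 - 3)%N.
Proof.
move=> gX S1; pose K : rel 'I_n := fun i j => i != j.
have rankK : (set_rank X K S <= #|S|.*2 - 3)%N.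
  have [m] := ubnP (n - #|S|); elim: m => // m IH in S S1 *; rewrite ltnS => Sm.
  have [ST|] := eqVneq S setT.
    rewrite ST cardsT card_ord in S1 *; exact: rank_rig_mx.
  rewrite -subTset => /subsetPn[v _ vS].
  have cS : #|v |: S| = #|S|.+1 by rewrite cardsU1 vS.
  have cn : (#|v |: S| <= n)%N by rewrite -[leqRHS]card_ord max_card.
  have /card_gt1P[a [b [aS bS ab]]] := S1.
  have neq x : x \in S -> K v x by move=> xS; apply: contraNneq vS => ->.
  have := set_rank_add2 gX vS aS bS ab (neq a aS) (neq b bS).
  have := IH (v |: S); rewrite cS in cn *; move: S1 Sm cn; clear.
  by move=> S1 Sm cn h1 h2; have := h1 _ _; lia.
have sub : (rig_mx X (induced e S) <= rig_mx X (induced K S))%MS.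
  apply/rig_mx_subP => i j /and3P[_ iS jS].
  have [->|ij] := eqVneq i j; last by apply: rig_row_sub; rewrite /induced iS jS /K ij.
  suff -> : rig_row X j j = 0 by exact: sub0mx.
  rewrite -[RHS](linear0 mxvec); congr mxvec; apply/matrixP => l k.
  by rewrite !mxE subrr mul0r.
exact: leq_trans (mxrankS sub) rankK.
Qed.

Lemma generic_rigidity_rank X e :
  generic X -> (forall i j, e i j = (i != j) && (rig_row X i j <= rig_mx X e)%MS) ->
  rigidity_rank e (set_rank X e).
Proof.
move=> gX closed.
have sub v (S : {set 'I_n}) : S \subset v |: S by exact: subsetUr.
split.
- by move=> S; exact: set_rank_le.
- by move=> v S; apply: mxrankS; apply: rig_mxS; exact: inducedS.
- move=> v a S vS aS va; apply: (@rank_add_neighbour _ _ X e _ S v a 0) => //.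
  + exact: inducedS.
  + by rewrite /induced va !inE eqxx aS orbT.
  + by apply: generic_neq => //; apply: contraNneq vS => ->.
- by move=> v a b S vS aS bS ab va vb; rewrite -addn2; exact: set_rank_add2 va vb.
- move=> v a b c S vS aS bS cS ab ac bc va vb vc nab; rewrite -addn3.
  apply: (generic_one_extension gX vS aS bS cS) => //.
  apply: contraNN nab => h; rewrite closed ab (submx_trans h) // rig_mxS //.
  by move=> i j /and3P[].
move=> S x y S1 rS xS yS xy; rewrite closed xy /=.
pose K : rel 'I_n := fun i j => i != j.
have eK : (rig_mx X (induced e S) <= rig_mx X (induced K S))%MS.
  apply: rig_mxS => i j /and3P[]; rewrite closed => /andP[ij _] iS jS.
  by rewrite /induced iS jS /K ij.
(* By the rank bound, the induced subgraph already spans all rows of the complete graph on [S]. *)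
have Ke : (rig_mx X (induced K S) <= rig_mx X (induced e S))%MS.
  rewrite -(geq_leqif (mxrank_leqif_sup eK)).
  exact: leq_trans (set_rank_le K gX S1) rS.
have xyK : (rig_row X x y <= rig_mx X (induced K S))%MS.
  by apply: rig_row_sub; rewrite /induced xS yS /K xy.
rewrite (submx_trans xyK) // (submx_trans Ke) // rig_mxS //.
by move=> i j /and3P[].
Qed.
End Generic.

(** * Continuity and induction on the unit interval *)

Section Continuity01.

Definition continuous01_at (t : R) (f : R -> R) : Prop :=
  forall eps : R, 0 < eps -> exists2 delta : R, 0 < delta &
    forall s : R, in01 s -> `|s - t| < delta -> `|f s - f t| < eps.

Variable t : R.

Lemma continuous01_cst c : continuous01_at t (fun=> c).
Proof. by move=> eps eps0; exists 1 => // s _ _; rewrite subrr normr0. Qed.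

Lemma continuous01_add f g : continuous01_at t f -> continuous01_at t g ->
  continuous01_at t (fun s => f s + g s).
Proof.
move=> cf cg eps eps0.
have eps2 : 0 < eps / 2%:R by lra.
have [d1 d10 h1] := cf _ eps2; have [d2 d20 h2] := cg _ eps2.
exists (Num.min d1 d2) => [|s s01]; first by rewrite lt_min d10.
rewrite lt_min => /andP[/(h1 s s01) f1 /(h2 s s01) g1].
rewrite (_ : _ - _ = (f s - f t) + (g s - g t)); last by ring.
by apply: le_lt_trans (ler_normD _ _) _; lra.
Qed.

Lemma continuous01_mul f g : continuous01_at t f -> continuous01_at t g ->
  continuous01_at t (fun s => f s * g s).
Proof.
move=> cf cg eps eps0.
have f0 := normr_ge0 (f t); have g0 := normr_ge0 (g t).
have e1 : 0 < eps / (2%:R * (`|g t| + 1)) by rewrite divr_gt0 //; lra.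
have e2 : 0 < eps / (2%:R * (`|f t| + 1)) by rewrite divr_gt0 //; lra.
(* The third radius only ensures [|g s| <= |g t| + 1] near [t]. *)
have [d1 d10 h1] := cf _ e1; have [d2 d20 h2] := cg _ e2; have [d3 d30 h3] := cg 1 ltr01.
exists (Num.min d1 (Num.min d2 d3)) => [|s s01]; first by rewrite !lt_min d10 d20.
rewrite !lt_min => /and3P[/(h1 s s01) f1 /(h2 s s01) g1 /(h3 s s01) g2].
rewrite (_ : _ - _ = (f s - f t) * g s + f t * (g s - g t)); last by ring.
apply: le_lt_trans (ler_normD _ _) _; rewrite !normrM.
have gs : `|g s| <= `|g t| + 1.
  rewrite (_ : g s = g t + (g s - g t)); last by ring.
  by apply: le_trans (ler_normD _ _) _; rewrite lerD2l ltW.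
have b1 : `|f s - f t| * `|g s| <= eps / 2%:R.
  apply: le_trans (ler_pM (normr_ge0 _) (normr_ge0 _) (ltW f1) gs) _.
  by rewrite invfM mulrA mulfVK //; lra.
have b2 : `|f t| * `|g s - g t| < eps / 2%:R.
  apply: le_lt_trans (ler_wpM2r (normr_ge0 _) (_ : _ <= `|f t| + 1)) _; first by lra.
  rewrite -ltr_pdivlMl; last by lra.
  by apply: lt_le_trans g1 _; rewrite invfM; lra.
lra.
Qed.

Lemma continuous01_sum (I : Type) (r : seq I) (P : pred I) (F : I -> R -> R) :
  (forall i, continuous01_at t (F i)) ->
  continuous01_at t (fun s => \sum_(i <- r | P i) F i s).
Proof.
move=> cF eps eps0; elim: r eps eps0 => [|i r IH] eps eps0.
  by exists 1 => // s _ _; rewrite !big_nil subrr normr0.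
have [delta d0 h] : exists2 delta, 0 < delta & forall s, in01 s -> `|s - t| < delta ->
   `|(if P i then F i s else 0) + \sum_(j <- r | P j) F j s -
     ((if P i then F i t else 0) + \sum_(j <- r | P j) F j t)| < eps.
  apply: (@continuous01_add (fun s => if P i then F i s else 0)) => //.
  by case: (P i) => //; exact: continuous01_cst.
exists delta => // s s01 st; rewrite !big_cons; have := h s s01 st.
by case: (P i); rewrite ?add0r.
Qed.

Lemma continuous01_prod (I : Type) (r : seq I) (P : pred I) (F : I -> R -> R) :
  (forall i, continuous01_at t (F i)) ->
  continuous01_at t (fun s => \prod_(i <- r | P i) F i s).
Proof.
move=> cF eps eps0; elim: r eps eps0 => [|i r IH] eps eps0.
  by exists 1 => // s _ _; rewrite !big_nil subrr normr0.
have [delta d0 h] : exists2 delta, 0 < delta & forall s, in01 s -> `|s - t| < delta ->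
   `|(if P i then F i s else 1) * \prod_(j <- r | P j) F j s -
     ((if P i then F i t else 1) * \prod_(j <- r | P j) F j t)| < eps.
  apply: (@continuous01_mul (fun s => if P i then F i s else 1)) => //.
  by case: (P i) => //; exact: continuous01_cst.
exists delta => // s s01 st; rewrite !big_cons; have := h s s01 st.
by case: (P i); rewrite ?mul1r.
Qed.

Lemma continuous01_det m (A : R -> 'M[R]_m) :
  (forall p q, continuous01_at t (fun s => A s p q)) ->
  continuous01_at t (fun s => \det (A s)).
Proof.
move=> cA; apply: continuous01_sum => u; apply: continuous01_mul.
  exact: continuous01_cst.
by apply: continuous01_prod => i; exact: cA.
Qed.

End Continuity01.

(** The supremum [T] of the initial segments where [P] holds satisfies [P] by the closedness
    hypothesis; openness excludes [T < t0]. *)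
Lemma interval_induction (P : R -> Prop) :
  P 0 ->
  (forall t, in01 t -> 0 < t -> (forall s, 0 <= s < t -> P s) -> P t) ->
  (forall t, in01 t -> P t -> exists2 delta : R, 0 < delta &
     forall s, in01 s -> `|s - t| < delta -> P s) ->
  forall t, in01 t -> P t.
Proof.
move=> P0 Pclosed Popen t0 /andP[t00 t01].
pose E t := in01 t /\ forall s, 0 <= s <= t -> P s.
have E0 : E 0.
  split=> [|s]; first by rewrite /in01 lexx ler01.
  by case/andP=> s0 s0'; rewrite (_ : s = 0) //; apply/le_anti/andP.
have [T [ubT lubT]] : {T | Raxioms.is_lub E T}.
  apply: Raxioms.completeness; last by exists 0.
  by exists 1 => x [/andP[_ x1] _]; exact/RleP.
have T0 : 0 <= T by apply/RleP; exact: ubT.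
have T1 : T <= 1 by apply/RleP/lubT => x [/andP[_ x1] _]; exact/RleP.
have below s : 0 <= s < T -> P s.
  case/andP=> s0 sT; case: (pselect (exists2 x, E x & s <= x)) => [[x [_ Ex] sx]|nE].
    by apply: Ex; rewrite s0.
  have : T <= s.
    apply/RleP/lubT => x Ex; apply/RleP; rewrite leNgt; apply/negP => sx.
    by apply: nE; exists x => //; exact: ltW.
  by rewrite leNgt sT.
have T01 : in01 T by apply/andP.
have PT : P T.
  have [T00|Tpos] := eqVneq T 0; first by rewrite T00.
  by apply: Pclosed => //; rewrite lt_neqAle eq_sym Tpos.
have PleT s : 0 <= s <= T -> P s.
  case/andP=> s0; rewrite le_eqVlt => /orP[/eqP-> //|sT].
  by apply: below; rewrite s0.
have [delta d0 near] := Popen T T01 PT.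
have [t0T|Tt0] := leP t0 T; first by apply: PleT; rewrite t00.
pose u := Num.min t0 (T + delta / 2%:R).
have Tu : T < u by rewrite lt_min Tt0 ltrDl divr_gt0.
have ut0 : u <= t0 by rewrite ge_min lexx.
have uT : u <= T + delta / 2%:R by rewrite ge_min lexx orbT.
have : u <= T.
  apply/RleP/ubT; split=> [|s /andP[s0 su]]; first by apply/andP; split; lra.
  have [sT|Ts] := leP s T; first by apply: PleT; rewrite s0.
  by apply: near; [apply/andP; split; lra | rewrite ger0_norm; lra].
by rewrite leNgt Tu.
Qed.

(** Over the reals, [u A A^T = 0] forces the sum of squares of [u A] to vanish. *)
Lemma rank_gram m n (A : 'M[R]_(m, n)) : \rank (A *m A^T) = \rank A.
Proof.
apply/eqP; rewrite eqn_leq mxrankM_maxl /=.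
have : (kermx (A *m A^T) <= kermx A)%MS.
  apply/row_subP => p; set u := row p _.
  have uAA : u *m A *m A^T = 0 by rewrite -mulmxA; apply/sub_kermxP; exact: row_sub.
  apply/sub_kermxP/rowP => q; rewrite [RHS]mxE.
  have : (u *m A *m (u *m A)^T) 0 0 = 0 by rewrite trmx_mul mulmxA uAA mul0mx mxE.
  rewrite mxE => /eqP; rewrite psumr_eq0 => [/allP/(_ q)|i _]; last first.
    by rewrite [X in _ * X]mxE -expr2 sqr_ge0.
  by rewrite mem_index_enum [X in _ * X]mxE mulf_eq0 orbb => /(_ isT)/eqP.
move/mxrankS; rewrite !mxrank_ker; have := rank_leq_row (A *m A^T).
have := rank_leq_row A; lia.
Qed.

(** * From full rank to rigidity *)

Section Frameworks.
Variable n : nat.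
Implicit Types (X Y : framework n) (e : rel 'I_n).

Lemma sqdist_polar X i j k l :
  \sum_c (X i c - X j c) * (X k c - X l c) =
  (sqdist X i l + sqdist X j k - sqdist X i k - sqdist X j l) / 2%:R.
Proof. by rewrite /sqdist !big_ord_recl !big_ord0; field. Qed.

(* Over the reals the rank is that of the Gram matrix of the rows, whose entries
   are functions of the squared distances. *)
Lemma rank_rig_mx_congruent X Y e :
  (forall i j, sqdist X i j = sqdist Y i j) ->
  \rank (rig_mx X e) = \rank (rig_mx Y e).
Proof.
move=> XY; rewrite -rank_gram -[RHS]rank_gram; congr mxrank.
have dot (Z : framework n) i j k l : (rig_row Z i j *m (rig_row Z k l)^T) 0 0 =
    ((i == k)%:R - (i == l)%:R - (j == k)%:R + (j == l)%:R) *
    ((sqdist Z i l + sqdist Z j k - sqdist Z i k - sqdist Z j l) / 2%:R).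
  rewrite rig_row_dot -(sqdist_polar Z) mulr_sumr; apply: eq_bigr => c _.
  by rewrite !mxE; ring.
apply/matrixP => p q.
have entry (Z : framework n) : (rig_mx Z e *m (rig_mx Z e)^T) p q =
    (row p (rig_mx Z e) *m (row q (rig_mx Z e))^T) 0 0.
  by rewrite !mxE; apply: eq_bigr => r _; rewrite !mxE.
rewrite !entry !rowK /=; case: (e _ _); last by rewrite !mul0mx.
case: (e _ _); last by rewrite !trmx0 !mulmx0.
by rewrite !dot !XY.
Qed.

(* [Y - X] flexes the midpoint framework infinitesimally: [|p|^2 - |q|^2] is the
   scalar product of [p + q] and [p - q]. *)
Lemma midpoint_rigid X Y e :
  (1 < n)%N -> (n.*2 - 3 <= \rank (rig_mx (2%:R^-1 *: (X + Y)) e))%N ->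
  (forall i j, e i j -> sqdist Y i j = sqdist X i j) ->
  forall i j, sqdist Y i j = sqdist X i j.
Proof.
move=> n1; set M := _ *: _ => rk eqe i j.
have dot k l : (rig_row M k l *m (mxvec (Y - X))^T) 0 0 =
    (sqdist Y k l - sqdist X k l) / 2%:R.
  by rewrite rig_row_dot /sqdist !big_ord_recl !big_ord0 !mxE; field.
have flex : (rig_mx M e <= kermx (mxvec (Y - X))^T)%MS.
  apply/rig_mx_subP => k l kl; apply/sub_kermxP/matrixP => p q.
  by rewrite !ord1 dot eqe // subrr mul0r mxE.
have eT : (rig_mx M e <= rig_mx M (fun _ _ => true))%MS by exact: rig_mxS.
have Te : (rig_mx M (fun _ _ => true) <= rig_mx M e)%MS.
  rewrite -(geq_leqif (mxrank_leqif_sup eT)).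
  exact: leq_trans (rank_rig_mx _ _ n1) rk.
have /sub_kermxP/matrixP/(_ 0 0) : (rig_row M i j <= kermx (mxvec (Y - X))^T)%MS.
  by apply: submx_trans flex; apply: submx_trans Te; exact: rig_row_sub.
rewrite dot mxE => h; lra.
Qed.

(** Interval induction on congruence to [X]: it persists in the limit by continuity of distances,
    and spreads to nearby times because the midpoint of [Y t] and [Y s] still has full rank. *)
Lemma rigid_of_rank X e :
  (1 < n)%N -> (n.*2 - 3 <= \rank (rig_mx X e))%N -> framework_rigid e X.
Proof.
move=> n1 rk Y cY Y0 eqe.
have cont i k t : in01 t -> continuous01_at t (fun s => Y s i k) by exact: cY.
have cdiff i j k t : in01 t -> continuous01_at t (fun s => Y s i k - Y s j k).
  move=> t01; apply: continuous01_add; first exact: cont.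
  rewrite (_ : (fun s => _) = fun s => -1 * Y s j k); last first.
    by apply: funext => s; rewrite mulN1r.
  by apply: continuous01_mul; [exact: continuous01_cst | exact: cont].
apply: interval_induction => [i j|t t01 t0 below i j|t t01 Pt].
- by rewrite Y0.
- apply/eqP; apply: contraT => neq.
  have csq : continuous01_at t (fun s => sqdist (Y s) i j).
    apply: continuous01_sum => k; apply: continuous01_mul; exact: cdiff.
  have [|delta d0 near] := csq `|sqdist (Y t) i j - sqdist X i j|.
    by rewrite normr_gt0 subr_eq0.
  have /andP[_ t1] := t01.
  (* An earlier time within [delta] of [t], where the distance is still the original one. *)
  pose s := Num.max 0 (t - delta / 2%:R).
  have s0 : 0 <= s by rewrite le_max lexx.
  have st : s < t by rewrite gt_max t0 /=; lra.
  have sd : t - delta / 2%:R <= s by rewrite le_max lexx orbT.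
  have s01 : in01 s by apply/andP; split; lra.
  have sdelta : `|s - t| < delta by rewrite distrC ger0_norm; lra.
  by have := near s s01 sdelta; rewrite below ?s0 // distrC ltxx.
have rkt : (n.*2 - 3 <= \rank (rig_mx (Y t) e))%N by rewrite (rank_rig_mx_congruent e Pt).
have [f [g fg]] := rank_minor (rig_mx (Y t) e).
pose M s := 2%:R^-1 *: (Y t + Y s).
have Mt : M t = Y t by apply/matrixP => i k; rewrite !mxE; field.
have cM : continuous01_at t (fun s => \det (mxsub f g (rig_mx (M s) e))).
  apply: continuous01_det => p q eps eps0.
  have [delta d0 h] : exists2 delta, 0 < delta & forall s, in01 s -> `|s - t| < delta ->
      `|rig_mx (M s) e (f p) (g q) - rig_mx (M t) e (f p) (g q)| < eps.
    move: eps eps0; case: (mxvec_indexP (g q)) => l k.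
    case ee : (e (enum_val (f p)).1 (enum_val (f p)).2); last first.
      move=> eps eps0; exists 1 => // s _ _; rewrite !mxE /= ee !mxE subrr normr0 //.
    set i := (enum_val _).1 in ee *; set j := (enum_val _).2 in ee *.
    (* At the midpoint, an entry is [c] times a coordinate difference of [Y s], plus a term constant
       in [s]. *)
    pose c := ((l == i)%:R - (l == j)%:R) * 2%:R^-1 : R.
    move=> eps eps0.
    have [|delta d0 h] :=
      @continuous01_mul t (fun=> c) _ (continuous01_cst t c) (cdiff i j k t t01) eps.
      by [].
    exists delta => // s s01 st; have := h s s01 st.
    rewrite !mxE /= -/i -/j ee !mxvecE !mxE -/i -/j; congr (`|_| < _).
    rewrite /c; ring.
  by exists delta => // s s01 st; rewrite [X in `|X - _|]mxE [X in `|_ - X|]mxE; exact: h.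
have [|delta d0 near] := cM `|\det (mxsub f g (rig_mx (M t) e))|.
  by rewrite normr_gt0 Mt.
exists delta => // s s01 st i j; rewrite -(Pt i j).
apply: (@midpoint_rigid (Y t) (Y s) e) => // [|k l kl]; last by rewrite !eqe.
apply: leq_trans rkt _; apply: (minor_rank (f := f) (g := g)).
apply: contraTneq (near s s01 st) => ->.
by rewrite sub0r normrN ltxx.
Qed.

End Frameworks.

(** * The exceptional 4-cycle and the conclusion *)

Lemma iso_C4_cycle (e : rel 'I_4) v a w b :
  simple_graph e -> uniq [:: v; a; w; b] -> e v a -> e a w -> e w b -> e b v ->
  ~~ e v w -> ~~ e a b -> iso_C4 e.
Proof.
move=> [esym eirr] U va aw wb bv nvw nab; set s := [:: v; a; w; b] in U.
have cover x : x \in s.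
  apply: contraT => xs; have : uniq (x :: s) by rewrite /= xs.
  by move/card_uniqP => cs; have := max_card (mem (x :: s)); rewrite cs card_ord.
pose f x : 'I_4 := inord (index x s).
have fE x : f x = index x s :> nat by rewrite inordK // ltnS -ltnS index_mem cover.
have f_nth k : (k < 4)%N -> f (nth v s k) = k :> nat by move=> k4; rewrite fE index_uniq.
exists f; split.
  apply: injF_bij => x y /(congr1 (@nat_of_ord 4)); rewrite !fE => xy.
  by rewrite -(nth_index v (cover x)) xy nth_index.
have fv := f_nth 0 isT; have fa := f_nth 1 isT; have fw := f_nth 2 isT; have fb := f_nth 3 isT.
rewrite /= in fv fa fw fb.
move=> x y; have := cover x; have := cover y; rewrite !inE /C4_adj.
case/or4P=> /eqP-> /or4P[] /eqP->; rewrite ?fv ?fa ?fw ?fb ?eirr ?(va, aw, wb, bv) //;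
  by [rewrite esym ?(va, aw, wb, bv)
    | rewrite ?(negPf nvw, negPf nab) // esym (negPf nvw, negPf nab)].
Qed.
(** If the closure is a 4-cycle, so is the graph itself: opposite vertices [v] and [w] have degree
    at most 2, and Ore's condition for them demands 4 in total, so no edge of the cycle is
    missing. *)
Lemma ore_subgraph_iso_C4 n (e e' : rel 'I_n) :
  simple_graph e -> subrel e e' -> irreflexive e' ->
  (forall u v : 'I_n, u != v -> ~~ e u v -> (n <= deg e u + deg e v)%N) ->
  is_C4 e' -> iso_C4 e.
Proof.
move=> sg sub irr' ore [v [a [b [w [n4 [va vb wa wb] vw ab [nvw nab]]]]]].
rewrite card_ord in n4; subst n; have [esym eirr] := sg.
have nvw' : ~~ e v w by apply: contraNN nvw; exact: sub.
have nab' : ~~ e a b by apply: contraNN nab; exact: sub.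
have neq x y : e' x y -> x != y by apply: contraTneq => ->; rewrite irr'.
pose C := ~: [set v; w].
have cC : #|C| = 2 by have := cardsC [set v; w]; rewrite cards2 vw card_ord -/C; clear; lia.
have subC x : x \in [set v; w] -> [set y | e x y] \subset C.
  rewrite !inE => xvw; apply/subsetP => y; rewrite !inE negb_or => xy.
  by apply/andP; split; apply: contraTneq xy => ->; case/orP: xvw => /eqP->;
    rewrite ?eirr // esym.
have sv := subC v (set21 v w); have sw := subC w (set22 v w).
have := ore v w vw nvw'; have := subset_leq_card sv; have := subset_leq_card sw.
rewrite cC /deg => lw lv sum.
have Nv : [set y | e v y] = C by apply/eqP; rewrite eqEcard sv cC; move: lw sum; clear; lia.
have Nw : [set y | e w y] = C by apply/eqP; rewrite eqEcard sw cC; move: lv sum; clear; lia.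
have inC x : e' v x -> e' w x -> e v x /\ e w x.
  move=> vx wx; have : x \in C by rewrite !inE negb_or !(eq_sym x) !neq.
  by move=> xC; split; [move: xC; rewrite -Nv inE | move: xC; rewrite -Nw inE].
have [eva ewa] := inC a va wa; have [evb ewb] := inC b vb wb.
apply: (@iso_C4_cycle e v a w b) => //; try by rewrite esym.
by rewrite /= !inE !negb_or (neq v a) // (neq v b) // vw ab (eq_sym a) (neq w a) // (neq w b).
Qed.

Theorem theorem5p3 (n : nat) (e : rel 'I_n) :
  simple_graph e -> ~ iso_C4 e ->
  (forall u v : 'I_n, u != v -> ~~ e u v -> (n <= deg e u + deg e v)%N) ->
  rigid2 e.
Proof.
move=> sg nC4 ore X gX; have [esym eirr] := sg.
have [n1|n1] := leqP n 1.
  move=> Y _ _ _ t _ i j; have -> : i = j.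
    by apply/val_inj => /=; have := ltn_ord i; have := ltn_ord j; lia.
  by rewrite /sqdist !big1 // => k _; rewrite subrr expr0n.
apply: rigid_of_rank => //.
(* The closure of the graph in the rigidity matroid at [X]; it spans the same rows, and degrees can
   only grow. *)
pose e' : rel 'I_n := fun i j => (i != j) && (rig_row X i j <= rig_mx X e)%MS.
have sub : subrel e e'.
  move=> i j ij; rewrite /e' rig_row_sub // andbT.
  by apply: contraTneq ij => ->; rewrite eirr.
have e'e : (rig_mx X e' <= rig_mx X e)%MS by apply/rig_mx_subP => i j /andP[].
have closed i j : e' i j = (i != j) && (rig_row X i j <= rig_mx X e')%MS.
  apply/idP/andP => [ij|[ij ije]]; first by rewrite rig_row_sub //; case/andP: ij.
  by rewrite /e' ij (submx_trans ije).
have e'sym : symmetric e' by move=> i j; rewrite /e' eq_sym rig_row_sym.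
have e'irr : irreflexive e' by move=> i; rewrite /e' eqxx.
have degS u : (deg e u <= #|nbhd e' u|)%N.
  by apply: subset_leq_card; apply/subsetP => x; rewrite !inE; exact: sub.
have ore' u v : u != v -> ~~ e' u v -> (#|'I_n| <= #|nbhd e' u| + #|nbhd e' v|)%N.
  move=> uv nuv; rewrite card_ord (leq_trans (ore u v uv _)) ?leq_add //.
  by apply: contraNN nuv; exact: sub.
have [|/(ore_subgraph_iso_C4 sg sub e'irr ore)//] :=
  ore_rank e'sym e'irr (generic_rigidity_rank gX closed) ore'.
rewrite card_ord => /leq_trans; apply; apply: mxrankS; apply: submx_trans e'e.
by apply: rig_mxS => i j /and3P[].
Qed.
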